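(* Let $q=q(n)$, $p=1-q$, and let $P$ be a random poset drawn from $\Omega(n,p)$. If $q=n^{-1/4}$, then asymptotically almost surely $\dim(P)\ge n-8n^{3/4}$; and if $q=n^{-4/5}$, then asymptotically almost surely $\dim(P)\le n-n^{4/5}$.
   Context: For a positive integer $n$, fix disjoint sets $A$ and $A'$, each of size $n$. $\Omega(n,p)$ is the probability space of posets $P$ on ground set $A\cup A'$ in which every element of $A$ is minimal and every element of $A'$ is maximal, and such that, independently for each pair $(a,a')\in A\times A'$, one has $a<a'$ in $P$ with probability $p$. A statement holds asymptotically almost surely (a.a.s.) if its probability tends to $1$ as $n\to\infty$. The dimension $\dim(P)$ of a poset $P$ is the least positive integer $d$ for which there are linear extensions $L_1,\dots,L_d$ of $P$ such that $x\le y$ in $P$ if and only if $x\le y$ in $L_j$ for each $j\in\{1,\dots,d\}$. *)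

(* Defs.v *)
(* MathComp and MathComp-Analysis. *)
From HB Require Import structures.
From mathcomp Require Import all_boot all_order all_algebra.
From mathcomp Require Import all_classical all_reals all_analysis.
Import Order.TTheory GRing.Theory Num.Theory.
Import numFieldNormedType.Exports.

Set Implicit Arguments.
Unset Strict Implicit.
Unset Printing Implicit Defensive.

Local Open Scope ring_scope.
Local Open Scope classical_set_scope.

Definition linear_extension (d : Order.disp_t) (T : porderType d)
    (L : rel T) : Prop :=
  [/\ reflexive L, antisymmetric L, transitive L, total L
    & forall x y : T, (x <= y)%O -> L x y].

Definition realizer (d : Order.disp_t) (T : porderType d) (k : nat)
    (L : 'I_k -> rel T) : Prop :=
  (forall j, linear_extension (L j)) /\
  (forall x y : T, (x <= y)%O <-> forall j, L j x y).

Definition realizable (d : Order.disp_t) (T : porderType d) (k : nat) : bool :=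
  (0 < k)%N && `[< exists L : 'I_k -> rel T, realizer L >].

(* If ~ (a <= b) (or a = b), adding the relation b <= a to the order keeps it
   an order; sorting by the size of down-sets (ties broken by enum_rank)
   extends the latter to a linear order. *)
Lemma linear_extension_separating (d : Order.disp_t) (T : finPOrderType d)
    (a b : T) : ~~ (a <= b)%O || (a == b) ->
  exists2 L : rel T, linear_extension L & (a != b -> ~~ L a b).
Proof.
move=> ab.
pose Q (u v : T) := (u <= v)%O || (u <= b)%O && (a <= v)%O.
have Qrefl u : Q u u by rewrite /Q lexx.
have Qtr : transitive Q.
  move=> v u w; rewrite /Q => /orP[uv|/andP[ub av]] /orP[vw|/andP[vb aw]].
  - by rewrite (le_trans uv vw).
  - by rewrite (le_trans uv vb) aw orbT.
  - by rewrite ub (le_trans av vw) orbT.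
  - by rewrite ub aw orbT.
have Qanti u v : Q u v -> Q v u -> u = v.
  have key : (a <= b)%O -> a = b.
    by move=> h; move: ab; rewrite h /= => /eqP.
  rewrite /Q => /orP[uv|/andP[ub av]] /orP[vu|/andP[vb au]].
  - by apply/eqP; rewrite eq_le uv vu.
  - have e := key (le_trans au (le_trans uv vb)).
    apply/eqP; rewrite eq_le uv /=.
    by apply: le_trans au; rewrite e.
  - have e := key (le_trans av (le_trans vu ub)).
    apply/eqP; rewrite eq_le vu andbT.
    by apply: le_trans av; rewrite e.
  - have e := key (le_trans av vb).
    apply/eqP; rewrite eq_le; apply/andP; split.
      by apply: le_trans av; rewrite e.
    by apply: le_trans au; rewrite e.
pose f (u : T) : nat := #|[set w | Q w u]%SET|.
have fQ u v : Q u v -> u != v -> (f u < f v)%N.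
  move=> uv nuv; apply: proper_card; apply/properP; split.
    by apply/fintype.subsetP => w; rewrite !inE => wu; apply: Qtr uv.
  exists v; rewrite inE ?Qrefl //; apply/negP => vu.
  by case/eqP: nuv; exact: Qanti.
pose g (u : T) : nat := enum_rank u.
have ginj : injective g by move=> u v /ord_inj /enum_rank_inj.
pose L (u v : T) := (f u < f v)%N || (f u == f v) && (g u <= g v)%N.
have LQ u v : Q u v -> L u v.
  move=> uv; have [->|nuv] := eqVneq u v; first by rewrite /L eqxx leqnn orbT.
  by rewrite /L fQ.
have Lanti : antisymmetric L.
  move=> u v; rewrite /L; case: (ltngtP (f u) (f v)) => //= _ guv.
  by apply: ginj; apply/eqP; rewrite eqn_leq.
exists L; last first.
  move=> nab; apply/negP => Lab; case/eqP: nab; apply: Lanti.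
  by rewrite Lab LQ // /Q !lexx orbT.
split => //.
- by move=> u; apply: LQ.
- move=> v u w; rewrite /L => /orP[uv|/andP[/eqP uv guv]].
    case/orP=> [vw|/andP[/eqP <- _]]; last by rewrite uv.
    by rewrite (ltn_trans uv vw).
  rewrite uv => /orP[->//|/andP[-> gvw]].
  by rewrite (leq_trans guv gvw) orbT.
- by move=> u v; rewrite /L; case: (ltngtP (f u) (f v)) => //= _; exact: leq_total.
- by move=> x y xy; apply: LQ; rewrite /Q xy.
Qed.

Lemma realizable_ex (d : Order.disp_t) (T : finPOrderType d) :
  exists k, realizable T k.
Proof.
have sep (z : option (T * T)) : exists L : rel T, linear_extension L /\
    forall x y, z = Some (x, y) -> ~~ (x <= y)%O -> ~~ L x y.
  have default (x : T) : exists2 L : rel T, linear_extension L & True.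
    by have [|L HL _] := @linear_extension_separating d T x x;
      [rewrite eqxx orbT | exists L].
  case: z => [[x y]|].
    have [xy|xy] := boolP (x <= y)%O.
      by have [L HL _] := default x; exists L; split=> // ? ? [<- <-]; rewrite xy.
    have [|L HL HLxy] := @linear_extension_separating d T x y; first by rewrite xy.
    exists L; split=> // ? ? [<- <-] _; apply: HLxy.
    by apply: contraNneq xy => ->.
  have [x _|T0] := pickP (@predT T).
    by have [L HL _] := default x; exists L.
  by exists (fun _ _ => true); split=> //; split=> // x; have := T0 x.
have [F HF] := choice sep.
exists #|{: option (T * T)}|; rewrite /realizable card_option /=.
apply/asboolP; rewrite -card_option.
exists (fun j => F (enum_val j)); split=> [j|x y]; first by case: (HF (enum_val j)).
split=> [xy j|H]; first by have [[_ _ _ _ ext] _] := HF (enum_val j); exact: ext.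
apply/negPn/negP => nxy.
have := H (enum_rank (Some (x, y))); rewrite enum_rankK.
by apply/negP; case: (HF (Some (x, y))) => _; apply.
Qed.

Definition order_dim (d : Order.disp_t) (T : finPOrderType d) : nat :=
  ex_minn (realizable_ex T).

(* The sets A and A' are the two summands of 'I_n + 'I_n; E is the set of pairs
   (a, a') in A x A' with a < a'. *)
Definition bipartite (n : nat) (E : {set 'I_n * 'I_n}) : Type :=
  ('I_n + 'I_n)%type.

HB.instance Definition _ n (E : {set 'I_n * 'I_n}) :=
  Finite.copy (bipartite E) ('I_n + 'I_n)%type.

Definition bipartite_le (n : nat) (E : {set 'I_n * 'I_n}) : rel (bipartite E) :=
  fun x y => (x == y) ||
    match x, y with inl a, inr a' => (a, a') \in E | _, _ => false end.

Lemma bipartite_le_refl (n : nat) (E : {set 'I_n * 'I_n}) :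
  reflexive (@bipartite_le n E).
Proof. by move=> x; rewrite /bipartite_le eqxx. Qed.

Lemma bipartite_le_anti (n : nat) (E : {set 'I_n * 'I_n}) :
  antisymmetric (@bipartite_le n E).
Proof.
move=> x y; rewrite /bipartite_le.
by case: (eqVneq x y) => [->//|_]; case: x => a; case: y => b //=; rewrite ?andbF.
Qed.

Lemma bipartite_le_trans (n : nat) (E : {set 'I_n * 'I_n}) :
  transitive (@bipartite_le n E).
Proof.
move=> y x z; rewrite /bipartite_le.
case: (eqVneq x y) => [->//|_]; case: (eqVneq y z) => [->|_]; first by move=> /= -> _; rewrite orbT.
by case: x => a; case: y => b; case: z.
Qed.

Fact bipartite_display : Order.disp_t. Proof. exact: Order.Disp tt tt. Qed.

HB.instance Definition _ n (E : {set 'I_n * 'I_n}) :=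
  Order.Le_isPOrder.Build bipartite_display (bipartite E)
    (@bipartite_le_refl n E) (@bipartite_le_anti n E) (@bipartite_le_trans n E).

(* Probability, in Omega(n, p), of the event A on the random set E of
   comparable pairs: the n ^ 2 pairs are independent Bernoulli(p) trials. *)
Definition Pr_Omega (R : realType) (n : nat) (p : R)
    (A : pred {set 'I_n * 'I_n}) : R :=
  \sum_(E : {set 'I_n * 'I_n} | A E)
    \prod_(e : 'I_n * 'I_n) (if e \in E then p else 1 - p).

(* p : nat -> R is the edge probability as a function of n. *)
Definition aas (R : realType) (p : nat -> R)
    (A : forall n, pred {set 'I_n * 'I_n}) : Prop :=
  Pr_Omega (p n) (A n) @[n --> \oo] --> (1 : R).

(* Main.v *)
Require Import Defs.
From HB Require Import structures.
From mathcomp Require Import all_boot all_order all_algebra.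
From mathcomp Require Import all_classical all_reals all_analysis.
From mathcomp Require Import ring lra zify.
Import Order.TTheory GRing.Theory Num.Theory.
Import numFieldNormedType.Exports.

Set Implicit Arguments.
Unset Strict Implicit.
Unset Printing Implicit Defensive.

Local Open Scope ring_scope.

(** Write [N] for the random set of incomparable pairs of A x A', in which each
pair lies with probability [q]. In a linear extension, the reversed pairs
form a subset of [N] whose neighbourhoods are nested, and a realizer reverses
every pair of [N]; so the dimension is governed by covers of [N] by such nested
bipartite graphs. The basic one is the double star, which consists of all
pairs of [N] at some [c] in A or at some [c'] in A'.

Lower bound, with [y = n^(1/4)] and [q = 1/y]. Suppose that there is a realizer
of size [t < n - 8 y^3], and let [s = n - t]. Choosing greedily, one gives the
extensions distinct topmost elements of A and distinct bottommost elements of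
A', which leaves sets [B], [B'] of size [s] (greedy_tops). If [(b, b')] in
[B x B'] is reversed in extension [j], then the elements of [B] from [b] upwards
and the chosen element [c_j] form a biclique of [N] with the corresponding
elements of A' from [b'] downwards. As [N] has no K_(9,9) (Pr_biclique9), one
side of this biclique, say the one in A, has at most 8 elements, so [b] is one
of the seven highest elements of [B]. If [b] is the highest one, then [b'] is
adjacent to both [b] and [c_j]; since the [c_j] are distinct, such pairs behave
like at most [n s] independent trials of probability [q^2], and there are at
most [2 s y^2] of them in all extensions together (Ex_pow_echoes,
Pr_many_echoes). If [b] is one of the next six, then [b'] is a common neighbour
of three elements of A, which leaves at most [5/3 y] choices
(Pr_large_codegree). Altogether at most [4 s y^2 + 20 y^5] pairs
can be reversed (realizer_cover), but [B x B'] contains more than [5/6 s^2 / y]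
pairs of [N] (Pr_few_incomparable), which is a contradiction for [s >= 8 y^3]
(order_dim_ge). All bounds hold simultaneously for all choices of the sets and
of the tops because the failure probabilities are [exp (- c y^5)] while there
are only [exp (O (y^4 ln y))] choices.

Upper bound, with [y = n^(1/5)] and [q = y^-4]. If [M] is a maximal matching of
[N] and the neighbourhoods in [N] are pairwise incomparable, then the double
stars centred at the edges of [M] give a realizer (maximal_matching_realizes),
so a maximal matching with at most [n - y^4] edges is needed. With
[k] about [y^4], any 13 k elements of A have a linear number of common
non-neighbours in [N], because [(1 - q)^(13 k)] is bounded below
(Pr_few_common_above); this gives an independent pair of sets of
size 13 k. Off these two sets, a maximum matching misses fewer than 12 k elements
of each side, for otherwise there would be an augmenting path with three edges
(max_matching_deficit, Pr_hole). In a maximal matching that extends it, at most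
[n - 13 k] edges start outside the chosen set in A, and fewer than [12 k] start
in it, since these end at missed elements; so there are fewer than [n - k] edges
(small_maximal_matching). *)

(** * Expectations over the random comparability graph *)

Definition weight (R : realType) n (p : R) (E : {set 'I_n * 'I_n}) : R :=
  \prod_e (if e \in E then p else 1 - p).

Definition Ex (R : realType) n (p : R) (f : {set 'I_n * 'I_n} -> R) : R :=
  \sum_E weight p E * f E.

Section Expectation.
Variables (R : realType) (n : nat) (p : R).
Hypotheses (p0 : 0 <= p) (p1 : p <= 1).
Let q := 1 - p.
Implicit Types (E S T : {set 'I_n * 'I_n}) (A B C : pred {set 'I_n * 'I_n}).

Lemma weight_ge0 E : 0 <= weight p E.
Proof. by apply: prodr_ge0 => e _; case: ifP => _ //; rewrite subr_ge0. Qed.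

Lemma Pr_OmegaE A : Pr_Omega p A = Ex p (fun E => (A E)%:R).
Proof.
rewrite /Pr_Omega /Ex big_mkcond /=; apply: eq_bigr => E _.
by case: ifP => _; rewrite ?mulr1 ?mulr0.
Qed.

(** Independence: the expectation of a product over the pairs factors, because
expanding the product of the sums gives one term for each random set. *)
Lemma Ex_prod (h : 'I_n * 'I_n -> bool -> R) :
  Ex p (fun E => \prod_e h e (e \in E))
  = \prod_e (p * h e true + q * h e false).
Proof.
rewrite bigA_distr; apply: eq_bigr => E _; rewrite -big_split /=.
by apply: eq_bigr => e _; case: ifP.
Qed.

Lemma Ex_le (f g : {set 'I_n * 'I_n} -> R) :
  (forall E, f E <= g E) -> Ex p f <= Ex p g.
Proof. by move=> fg; apply: ler_sum => E _; rewrite ler_wpM2l ?weight_ge0. Qed.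

Lemma eq_Ex (f g : {set 'I_n * 'I_n} -> R) : f =1 g -> Ex p f = Ex p g.
Proof. by move=> fg; apply: eq_bigr => E _; rewrite fg. Qed.

Lemma Ex_sum (I : finType) (P : pred I) (f : I -> {set 'I_n * 'I_n} -> R) :
  Ex p (fun E => \sum_(i | P i) f i E) = \sum_(i | P i) Ex p (f i).
Proof.
rewrite /Ex exchange_big /=; apply: eq_bigr => E _.
by rewrite mulr_sumr.
Qed.

Lemma Ex_scale (c : R) (f : {set 'I_n * 'I_n} -> R) :
  Ex p (fun E => c * f E) = c * Ex p f.
Proof. by rewrite /Ex mulr_sumr; apply: eq_bigr => E _; rewrite mulrCA. Qed.

Lemma Ex1 : Ex p (fun _ : {set 'I_n * 'I_n} => 1) = 1.
Proof.
have := Ex_prod (fun _ _ => 1).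
rewrite (@eq_Ex _ (fun=> 1)) => [->|E]; last by rewrite big1.
by rewrite big1 // => e _; rewrite !mulr1 /q addrC subrK.
Qed.

Lemma Pr_le A (f : {set 'I_n * 'I_n} -> R) :
  (forall E, 0 <= f E) -> (forall E, A E -> 1 <= f E) -> Pr_Omega p A <= Ex p f.
Proof.
move=> f0 f1; rewrite Pr_OmegaE; apply: Ex_le => E.
by case: (boolP (A E)) => [/f1|_].
Qed.

Lemma Pr_markov A (f : {set 'I_n * 'I_n} -> R) (k : R) : 0 < k ->
  (forall E, 0 <= f E) -> (forall E, A E -> k <= f E) ->
  Pr_Omega p A <= k^-1 * Ex p f.
Proof.
move=> k0 f0 fk; rewrite -Ex_scale; apply: Pr_le => E.
  by rewrite mulr_ge0 // invr_ge0 ltW.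
by move=> /fk; rewrite -ler_pdivrMl ?invr_gt0 // invrK mulr1.
Qed.

Lemma Pr_compl A : 1 - Pr_Omega p A = Pr_Omega p (predC A).
Proof.
rewrite -Ex1 !Pr_OmegaE /Ex -sumrB; apply: eq_bigr => E _.
by rewrite -mulrBr /=; case: (A E); rewrite ?subrr ?subr0.
Qed.

Lemma Pr_ge0 A : 0 <= Pr_Omega p A.
Proof. by apply: sumr_ge0 => E _; exact: weight_ge0. Qed.

Lemma Pr_union (I : finType) (P : pred I) A (B : I -> pred {set 'I_n * 'I_n})
    (d : R) :
  (forall E, A E -> exists2 i, P i & B i E) ->
  (forall i, P i -> Pr_Omega p (B i) <= d) -> Pr_Omega p A <= #|P|%:R * d.
Proof.
move=> AB Bd.
have: Pr_Omega p A <= \sum_(i | P i) Pr_Omega p (B i).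
  rewrite (eq_bigr _ (fun i _ => Pr_OmegaE (B i))) -Ex_sum.
  apply: Pr_le => [E|E /AB [i Pi Bi]]; first by apply: sumr_ge0.
  by rewrite (bigD1 i) //= Bi lerDl sumr_ge0.
by move/le_trans; apply; rewrite mulr_natl -sumr_const; exact: ler_sum.
Qed.

Lemma Pr_union2 A B C : (forall E, A E -> B E \/ C E) ->
  Pr_Omega p A <= Pr_Omega p B + Pr_Omega p C.
Proof.
move=> ABC; rewrite !Pr_OmegaE /Ex -big_split /=; apply: ler_sum => E _.
rewrite -mulrDr ler_wpM2l ?weight_ge0 // -natrD ler_nat.
by case: (boolP (A E)) => // /ABC [->|->]; rewrite ?addn1.
Qed.

Lemma Ex_exp S (a b : R) :
  Ex p (fun E => \prod_(e in S) (if e \in E then a else b))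
  = (p * a + q * b) ^+ #|S|.
Proof.
transitivity (Ex p (fun E => \prod_e
    (if e \in S then if e \in E then a else b else 1))).
  by apply: eq_Ex => E; rewrite big_mkcond.
rewrite (Ex_prod (fun e x => if e \in S then if x then a else b else 1)).
rewrite -prodr_const [RHS]big_mkcond; apply: eq_bigr => e _.
by case: ifP => // _; rewrite !mulr1 /q addrC subrK.
Qed.

Lemma Pr_cylinder S T : [disjoint S & T] ->
  Pr_Omega p (fun E => [disjoint S & E] && (T \subset E))
  = q ^+ #|S| * p ^+ #|T|.
Proof.
move=> dST; rewrite Pr_OmegaE.
pose h (e : 'I_n * 'I_n) (x : bool) : R :=
  if e \in S then (~~ x)%:R else if e \in T then x%:R else 1.
rewrite (@eq_Ex _ (fun E => \prod_e h e (e \in E))) => [|E].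
  rewrite Ex_prod -!prodr_const !(big_mkcond (fun e => e \in _)) -big_split /=.
  apply: eq_bigr => e _; rewrite /h.
  have [eS|eS] := boolP (e \in S).
    by rewrite (disjointFr dST eS) !mulr0 !mulr1 add0r.
  case: ifP => _; rewrite ?mulr0 ?mul1r ?mulr1 ?addr0 //.
  by rewrite /q addrC subrK.
case: (boolP [disjoint S & E]) => [dSE|] /=; last first.
  rewrite disjoint_subset => /fintype.subsetPn[e eS]; rewrite !inE negbK => eE.
  by rewrite (bigD1 e) //= /h eS eE mul0r.
case: (boolP (T \subset E)) => [TE|/fintype.subsetPn[e eT eE]].
  rewrite big1 // => e _; rewrite /h; case: ifP => eS.
    by rewrite (disjointFr dSE eS).
  by case: ifP => // eT; rewrite (fintype.subsetP TE).
by rewrite (bigD1 e) //= /h (disjointFl dST eT) eT (negbTE eE) mul0r.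
Qed.

Lemma Pr_avoid S : Pr_Omega p (fun E => [disjoint S & E]) = q ^+ #|S|.
Proof.
have := @Pr_cylinder S finset.set0; rewrite cards0 expr0 mulr1 => <-.
  by rewrite !Pr_OmegaE; apply: eq_Ex => E; rewrite finset.sub0set andbT.
by rewrite -finset.setI_eq0 finset.setI0.
Qed.

(** Different elements [b] of A' depend on disjoint sets of pairs. Independence is
obtained without grouping coordinates: the product is expanded over the
subsets [T] of A', and each term is a cylinder event on [U x T] and [V x T]. *)
Lemma Ex_columns (U V : {set 'I_n}) (x : R) : [disjoint U & V] ->
  Ex p (fun E => \prod_(b < n)
    (1 + x * [forall u in U, (u, b) \notin E]%:R
           * [forall v in V, (v, b) \in E]%:R))
  = (1 + x * q ^+ #|U| * p ^+ #|V|) ^+ n.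
Proof.
move=> dUV.
transitivity (\sum_(T : {set 'I_n}) x ^+ #|T| *
    Ex p (fun E => ([disjoint finset.setX U T & E]
                    && (finset.setX V T \subset E))%:R)).
  under [RHS]eq_bigr do rewrite -Ex_scale.
  rewrite -Ex_sum.
  apply: eq_Ex => E; under eq_bigr do rewrite addrC.
  rewrite bigA_distr; apply: eq_bigr => T _.
  rewrite -(big_mkcond (fun b => b \in T)) /=.
  rewrite (eq_bigr (fun b => x * ([forall u in U, (u, b) \notin E]
      && [forall v in V, (v, b) \in E])%:R)); last first.
    by move=> b _; rewrite -mulrA -natrM mulnb.
  rewrite big_split prodr_const /=; congr (_ * _).
  have [/andP[dU sV]|nUV] := boolP (_ && _).
    rewrite big1 // => b bT; apply/eqP; rewrite pnatr_eq1 eqb1.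
    apply/andP; split; apply/forall_inP => u uU.
      by rewrite (disjointFr dU) // finset.in_setX uU.
    by rewrite (fintype.subsetP sV) // finset.in_setX uU.
  suff [b bT nb] : exists2 b, b \in T & ~~ ([forall u in U, (u, b) \notin E]
      && [forall v in V, (v, b) \in E]).
    by rewrite (bigD1 b) //= (negbTE nb) mul0r.
  move: nUV; rewrite negb_and disjoint_subset => /orP[|] /fintype.subsetPn[[u b]].
    rewrite finset.in_setX !inE negbK => /andP[/= uU bT] ub; exists b => //.
    by rewrite negb_and; apply/orP; left; apply/forall_inPn; exists u; rewrite ?negbK.
  rewrite finset.in_setX => /andP[/= uU bT] ub; exists b => //.
  by rewrite negb_and; apply/orP; right; apply/forall_inPn; exists u.
rewrite (eq_bigr (fun T : {set 'I_n} => \prod_(b < n)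
    (if b \in T then x * q ^+ #|U| * p ^+ #|V| else 1))); last first.
  move=> T _; rewrite -Pr_OmegaE Pr_cylinder.
    rewrite !cardsX -(big_mkcond (fun b => b \in T)) /= prodr_const.
    by rewrite !exprM mulrA !exprMn.
  apply/pred0P => -[u b] /=; rewrite !finset.in_setX /=.
  by have [/(disjointFr dUV)->|] := boolP (u \in U); rewrite ?andbF.
by rewrite -bigA_distr /= prodr_const card_ord addrC.
Qed.

End Expectation.

(** Exchanging the roles of A and A'. *)
Definition transpose n (E : {set 'I_n * 'I_n}) : {set 'I_n * 'I_n} :=
  [set e | (e.2, e.1) \in E]%SET.

Lemma in_transpose n (E : {set 'I_n * 'I_n}) a b :
  ((a, b) \in transpose E) = ((b, a) \in E).
Proof. by rewrite inE. Qed.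

Lemma transposeK n : involutive (@transpose n).
Proof. by move=> E; apply/finset.setP => -[a b]; rewrite !in_transpose. Qed.

Lemma transposeC n (E : {set 'I_n * 'I_n}) : transpose (~: E)%SET = (~: transpose E)%SET.
Proof. by apply/finset.setP => e; rewrite !inE. Qed.

Lemma Pr_transpose (R : realType) n (p : R) (A : pred {set 'I_n * 'I_n}) :
  Pr_Omega p (fun E => A (transpose E)) = Pr_Omega p A.
Proof.
rewrite [RHS]/Pr_Omega (reindex_inj (inv_inj (@transposeK n))) /=.
apply: eq_bigr => E _.
rewrite (reindex_inj (inv_inj (_ : involutive (fun e : 'I_n * 'I_n => (e.2, e.1))))) /=.
  by apply: eq_bigr => -[a b] _; rewrite inE.
by case.
Qed.

(** * Covering the incomparable pairs by linear extensions *)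

Lemma total_top (T : finType) (r : rel T) (A : {set T}) (a0 : T) :
  reflexive r -> transitive r -> total r -> a0 \in A ->
  exists2 x, x \in A & {in A, forall b, r b x}.
Proof.
move=> rr rt rtot a0A.
pose ge x y := r y x.
have ge_refl : reflexive ge by exact: rr.
have ge_trans : transitive ge by move=> y x z yx zy; exact: rt zy yx.
have ge_total : total ge by move=> x y; exact: rtot.
have [x xA top] := extremumP (P := fun x => x \in A) id
  ge_refl ge_trans ge_total a0A.
by exists x.
Qed.

(** The relations are treated one at a time, each taking the top of the elements
not yet taken; later choices only shrink the complement of the image. *)
Lemma greedy_tops (T I : finType) (x0 : T) (r : I -> rel T) :
  (forall i, reflexive (r i)) -> (forall i, transitive (r i)) ->
  (forall i, total (r i)) -> (#|I| <= #|T|)%N ->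
  exists2 c : I -> T, injective c
    & forall i b, b \notin [set c j | j in I]%SET -> r i b (c i).
Proof.
move=> rr rt rtot leIT.
suff H (s : seq I) : uniq s -> (size s <= #|T|)%N ->
    exists2 c : I -> T, {in s &, injective c}
      & forall i b, i \in s -> b \notin map c s -> r i b (c i).
  have [||c cinj ctop] := H (enum I); rewrite ?enum_uniq -?cardE //.
  exists c => [i j|i b nb]; first by apply: cinj; rewrite mem_enum.
  apply: ctop; rewrite ?mem_enum //; apply: contra nb => /mapP[j _ ->].
  by rewrite imset_f.
elim: s => [|i0 s IH] /=; first by exists (fun=> x0).
move=> /andP[i0s us] szs; have [c cinj ctop] := IH us (ltnW szs).
have [a0 a0s] : exists a, a \notin map c s.
  apply/existsP; rewrite -[[exists _, _]]negbK negb_exists; apply/negP => /forallP H.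
  have: (#|T| <= size (map c s))%N.
    apply: leq_trans (card_size _); apply/subset_leq_card/fintype.subsetP => x _.
    by have := H x; rewrite negbK.
  by rewrite size_map leqNgt szs.
have [|x] := @total_top T (r i0) [set a | a \notin map c s]%SET a0 (rr _) (rt _) (rtot _).
  by rewrite inE.
rewrite inE => xs xtop.
have old i : i \in s -> i == i0 = false.
  by move=> iis; apply: contraNF i0s => /eqP <-.
exists (fun i => if i == i0 then x else c i).
  move=> i j; rewrite !inE.
  case: eqVneq => [->|ni] /=; case: eqVneq => [->|nj] //= iis jis.
  - by move=> e; move: xs; rewrite e map_f.
  - by move=> e; move: xs; rewrite -e map_f.
  - exact: cinj.
rewrite eqxx => i b; rewrite inE => /orP[/eqP ->|iis].
  rewrite eqxx inE negb_or => /andP[_ nb]; apply: xtop; rewrite inE.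
  apply: contra nb => /mapP[j js ->]; apply/mapP; exists j => //.
  by rewrite old.
rewrite old // inE negb_or => /andP[_ nb]; apply: ctop => //.
apply: contra nb => /mapP[j js ->]; apply/mapP; exists j => //.
by rewrite old.
Qed.

Lemma leq_card_bigcup (I T : finType) (P : pred I) (F : I -> {set T}) :
  (#|\bigcup_(i | P i) F i| <= \sum_(i | P i) #|F i|)%N.
Proof.
elim/big_rec2: _ => [|i m A _ IH]; first by rewrite cards0.
by apply: leq_trans (leq_card_setU _ _) _; rewrite leq_add2l.
Qed.

(** When [phi] sends the top [c_j] of extension [j] to the
top [d_j] of [B], a pair [(d_j, b')] can be reversed in extension [j] only if
[(c_j, b')] lies in [G] as well. Indexing by [c] rather than by [j] is possible
because the [c_j] are distinct. *)
Definition echoes n (G : {set 'I_n * 'I_n}) (phi : {ffun 'I_n -> 'I_n})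
    (B B' : {set 'I_n}) : {set 'I_n * 'I_n} :=
  [set e in G | [&& e.1 \in B, e.2 \in B'
    & [exists c, [&& c \notin B, phi c == e.1 & (c, e.2) \in G]]]]%SET.

Definition triple_codegree_le n (G : {set 'I_n * 'I_n}) (M : nat) :=
  forall a1 a2 a3 : 'I_n, a1 != a2 -> a1 != a3 -> a2 != a3 ->
  (#|[set b | [&& (a1, b) \in G, (a2, b) \in G & (a3, b) \in G]]%SET| <= M)%N.

(** The elements of [B] that are above [b] for [r], together with the centre [c]. *)
Definition upset n (r : rel 'I_n) (c : 'I_n) (B : {set 'I_n}) (b : 'I_n) :=
  [set u | (u == c) || (u \in B) && r b u]%SET.

(** The size of the upset is injective on [B]. So for each [j] there is one vertex
with an upset of size 2, whose pairs are echoes, and at most six vertices with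
an upset of size 3 to 8, each with at most [M] neighbours, since these are also
neighbours of [c j] and of the top of [B]. *)
Lemma shallow_pairs n t M (G : {set 'I_n * 'I_n}) (r : 'I_t -> rel 'I_n)
    (c : 'I_t -> 'I_n) (B B' : {set 'I_n}) :
  (forall j, reflexive (r j)) -> (forall j, antisymmetric (r j)) ->
  (forall j, transitive (r j)) -> (forall j, total (r j)) ->
  injective c -> (forall j, c j \notin B) -> triple_codegree_le G M ->
  exists phi : {ffun 'I_n -> 'I_n},
    (#|[set e | [&& e.1 \in B, e.2 \in B' & [exists j,
         (#|upset (r j) (c j) B e.1| <= 8)%N
         && [forall u in upset (r j) (c j) B e.1, (u, e.2) \in G]]]]%SET|
      <= #|echoes G phi B B'| + t * (6 * M))%N.
Proof.
move=> rr ra rt rtot cinj cB codeg.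
have [B0|[b0 b0B]] := set_0Vmem B.
  exists [ffun a => a]; rewrite eq_card0 // => e.
  by rewrite inE B0 inE.
have [d dB dtop] : exists2 d : 'I_t -> 'I_n, forall j, d j \in B
    & forall j, {in B, forall b, r j b (d j)}.
  exact: fin_all_exists2 (fun j => total_top (rr j) (rt j) (rtot j) b0B).
exists [ffun a => if [pick j | c j == a] is Some j then d j else a].
set phi := finfun _.
have phic j : phi (c j) = d j.
  by rewrite ffunE; case: pickP => [k /eqP/cinj->|/(_ j)]; rewrite ?eqxx.
(* The vertices with upsets of size 3 to 8. *)
pose D j := [set b in B | (b != d j) && (#|upset (r j) (c j) B b| <= 8)%N]%SET.
have upP j b : b \in B -> {subset [:: c j; d j; b] <= upset (r j) (c j) B b}.
  move=> bB x; rewrite !inE => /or3P[] /eqP->; rewrite ?eqxx //.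
    by rewrite dB dtop ?orbT.
  by rewrite bB rr orbT.
have ncB j b : b \in B -> b == c j = false.
  by move=> bB; apply: contraNF (cB j) => /eqP <-.
have upI j : {in B &, injective (fun b => #|upset (r j) (c j) B b|)}.
  suff up_lt b b' : b \in B -> b' \in B -> b != b' -> r j b b' ->
      (#|upset (r j) (c j) B b'| < #|upset (r j) (c j) B b|)%N.
    move=> b b' bB b'B; apply: contra_eq => nb.
    have [le|le] := orP (rtot j b b').
      by rewrite gtn_eqF // up_lt.
    by rewrite ltn_eqF // up_lt // eq_sym.
  move=> bB b'B nb le; apply/proper_card/properP; split.
    apply/fintype.subsetP => x; rewrite !inE => /orP[->//|/andP[-> le']].
    by rewrite (rt j _ _ _ le le') orbT.
  exists b; rewrite !inE ?bB ?rr ?orbT // (ncB j) //=.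
  by apply: contra nb => le'; apply/eqP/(ra j); rewrite le le'.
have cardD j : (#|D j| <= 6)%N.
  rewrite cardE -(size_map (fun b => #|upset (r j) (c j) B b|)).
  apply: (@uniq_leq_size _ _ (iota 3 6)).
    rewrite map_inj_in_uniq ?enum_uniq // => b b'.
    by rewrite !mem_enum !inE => /andP[bB _] /andP[b'B _]; exact: upI.
  move=> k /mapP[b]; rewrite mem_enum => bD ->; rewrite mem_iota.
  move: bD; rewrite inE => /and3P[bB nb le8]; apply/andP; split=> //.
  have u3 : uniq [:: c j; d j; b].
    by rewrite /= !inE negb_or !(eq_sym (c j)) !ncB // eq_sym nb.
  apply: (@leq_trans #|[:: c j; d j; b]|); first by rewrite (card_uniqP u3).
  by apply/subset_leq_card/fintype.subsetP/upP.
pose Z j := (\bigcup_(b in D j)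
  [set (b, x) | x in [set x | [&& (c j, x) \in G, (d j, x) \in G & (b, x) \in G]]])%SET.
have cardZ j : (#|Z j| <= 6 * M)%N.
  apply: leq_trans (leq_card_bigcup _ _) _.
  apply: (@leq_trans (\sum_(b in D j) M)).
    apply: leq_sum => b; rewrite !inE => /and3P[bB nb _].
    apply: leq_trans (leq_imset_card _ _) _; apply: codeg.
    - by rewrite eq_sym ncB.
    - by rewrite eq_sym ncB.
    - by rewrite eq_sym.
  by rewrite sum_nat_const leq_mul2r cardD orbT.
have cover : [set e | [&& e.1 \in B, e.2 \in B' & [exists j,
      (#|upset (r j) (c j) B e.1| <= 8)%N
      && [forall u in upset (r j) (c j) B e.1, (u, e.2) \in G]]]]%SET
    \subset (echoes G phi B B' :|: \bigcup_j Z j)%SET.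
  apply/fintype.subsetP => -[b x]; rewrite inE /=.
  case/and3P=> bB xB' /existsP[j /andP[le8 /forall_inP upG]].
  have cG : (c j, x) \in G by apply/upG/upP => //; rewrite !inE eqxx.
  have dG : (d j, x) \in G by apply/upG/upP => //; rewrite !inE eqxx orbT.
  have bG : (b, x) \in G by apply/upG/upP => //; rewrite !inE eqxx !orbT.
  rewrite inE; have [bd|nbd] := eqVneq b (d j).
    apply/orP; left; rewrite !inE bG /= bB xB'; apply/existsP; exists (c j).
    by rewrite cB phic bd eqxx.
  apply/orP; right; apply/bigcupP; exists j => //; apply/bigcupP; exists b.
    by rewrite !inE bB nbd.
  by apply: imset_f; rewrite inE cG dG.
apply: leq_trans (subset_leq_card cover) _.
apply: leq_trans (leq_card_setU _ _) _; rewrite leq_add2l.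
apply: leq_trans (leq_card_bigcup _ _) _.
apply: (@leq_trans (\sum_(j < t) 6 * M)); first exact: leq_sum.
by rewrite sum_nat_const card_ord.
Qed.

Definition biclique9_free n (G : {set 'I_n * 'I_n}) :=
  forall U U' : {set 'I_n}, (8 < #|U|)%N -> (8 < #|U'|)%N ->
  ~~ (finset.setX U U' \subset G).

(** If [(b, b')] is reversed in extension [j], then so is every pair of the upset
of [b] and the downset of [b']; a biclique-free [G] makes one of them small. *)
Lemma realizer_cover n (E : {set 'I_n * 'I_n}) t M : let G := (~: E)%SET in
  realizable (bipartite E) t -> (t < n)%N -> biclique9_free G ->
  triple_codegree_le G M -> triple_codegree_le (transpose G) M ->
  exists B B' : {set 'I_n}, exists phi phi' : {ffun 'I_n -> 'I_n},
  [/\ #|B| = (n - t)%N, #|B'| = (n - t)%N &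
    (#|G :&: finset.setX B B'| <= #|echoes G phi B B'|
       + #|echoes (transpose G) phi' B' B| + 12 * (t * M))%N].
Proof.
move=> G /andP[_ /asboolP[L [Lext Lreal]]] ltn K9 cod cod'.
have n0 : (0 < n)%N by exact: leq_ltn_trans ltn.
pose r j : rel 'I_n := fun a b => L j (inl a : bipartite E) (inl b : bipartite E).
pose r' j : rel 'I_n := fun a b => L j (inr b : bipartite E) (inr a : bipartite E).
have rr j : reflexive (r j) by have [h _ _ _ _] := Lext j => a; exact: h.
have ra j : antisymmetric (r j) by have [_ h _ _ _] := Lext j => a b /h[].
have rt j : transitive (r j) by have [_ _ h _ _] := Lext j => a b c; exact: h.
have rtot j : total (r j) by have [_ _ _ h _] := Lext j => a b; exact: h.
have rr' j : reflexive (r' j) by have [h _ _ _ _] := Lext j => a; exact: h.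
have ra' j : antisymmetric (r' j).
  by have [_ h _ _ _] := Lext j => a b; rewrite andbC => /h[].
have rt' j : transitive (r' j).
  by have [_ _ h _ _] := Lext j => a b c ab bc; exact: h bc ab.
have rtot' j : total (r' j) by have [_ _ _ h _] := Lext j => a b; exact: h.
have leIT : (#|'I_t| <= #|'I_n|)%N by rewrite !card_ord ltnW.
have [c cinj ctop] := greedy_tops (Ordinal n0) rr rt rtot leIT.
have [c' cinj' ctop'] := greedy_tops (Ordinal n0) rr' rt' rtot' leIT.
pose B := (~: [set c j | j in 'I_t])%SET; pose B' := (~: [set c' j | j in 'I_t])%SET.
have cB j : c j \notin B by rewrite inE negbK imset_f.
have cB' j : c' j \notin B' by rewrite inE negbK imset_f.
have [phi Hphi] := shallow_pairs B' rr ra rt rtot cinj cB cod.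
have [phi' Hphi'] := shallow_pairs B rr' ra' rt' rtot' cinj' cB' cod'.
exists B, B', phi, phi'; split.
- by rewrite cardsCs finset.setCK card_imset // !card_ord.
- by rewrite cardsCs finset.setCK card_imset // !card_ord.
move: Hphi Hphi'; set S := finset _; set S' := finset _ => Hphi Hphi'.
have cover : (G :&: finset.setX B B' \subset S :|: transpose S')%SET.
  apply/fintype.subsetP => -[b b']; rewrite inE => /andP[bG].
  rewrite finset.in_setX /= => /andP[bB b'B'].
  have [j Lj] : exists j, ~~ L j (inl b : bipartite E) (inr b' : bipartite E).
    apply/existsP; rewrite -negb_forall; apply/negP => /forallP /(Lreal _ _).
    by rewrite /Order.le /= /bipartite_le /= => bE; rewrite inE bE in bG.
  have [_ Lanti Ltr Ltot Lle] := Lext j.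
  have {}Lj : L j (inr b' : bipartite E) (inl b : bipartite E).
    by have := Ltot (inr b' : bipartite E) (inl b : bipartite E); rewrite (negbTE Lj) orbF.
  pose U := upset (r j) (c j) B b; pose U' := upset (r' j) (c' j) B' b'.
  have upU u : u \in U -> L j (inl b : bipartite E) (inl u : bipartite E).
    by rewrite inE => /orP[/eqP->|/andP[]//]; apply: ctop; rewrite !inE in bB.
  have upU' u : u \in U' -> L j (inr u : bipartite E) (inr b' : bipartite E).
    by rewrite inE => /orP[/eqP->|/andP[]//]; apply: ctop'; rewrite !inE in b'B'.
  have UG u u' : u \in U -> u' \in U' -> (u, u') \in G.
    move=> /upU Lbu /upU' Lub; rewrite inE; apply/negP => uE.
    have /Lle Luu : (inl u <= inr u' :> bipartite E)%O.
      by rewrite /Order.le /= /bipartite_le /=.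
    have := Lanti (inl u : bipartite E) (inr u' : bipartite E).
    by rewrite Luu (Ltr _ _ _ Lub (Ltr _ _ _ Lj Lbu)) => /(_ isT).
  have bU : b \in U by rewrite inE bB rr orbT.
  have bU' : b' \in U' by rewrite inE b'B' rr' orbT.
  rewrite inE; have [le8|gt8] := leqP #|U| 8.
    apply/orP; left; rewrite inE /= bB b'B'; apply/existsP; exists j.
    by rewrite le8; apply/forall_inP => u uU; exact: UG.
  have [le8|gt8'] := leqP #|U'| 8.
    apply/orP; right; rewrite in_transpose inE /= bB b'B'; apply/existsP; exists j.
    by rewrite le8; apply/forall_inP => u uU; rewrite in_transpose UG.
  have /negP[] := K9 U U' gt8 gt8'; apply/fintype.subsetP => -[u u'].
  by rewrite finset.in_setX => /andP[]; exact: UG.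
have cardT (F : {set 'I_n * 'I_n}) : #|transpose F| = #|F|.
  rewrite -[RHS](card_imset _ (inv_inj (_ : involutive (fun e : 'I_n * 'I_n => (e.2, e.1))))).
    apply: eq_card => -[x y]; rewrite in_transpose; apply/idP/imsetP.
      by exists (y, x).
    by case=> -[u v] uv [-> ->].
  by case.
apply: leq_trans (subset_leq_card cover) _.
apply: leq_trans (leq_card_setU _ _) _; rewrite cardT.
apply: leq_trans (leq_add Hphi Hphi') _.
by rewrite addnACA leq_add2l -mulnDr -mulnDl mulnCA leqnn.
Qed.

(** * Realizers from maximal matchings *)

Definition matching n (M : {set 'I_n * 'I_n}) : bool :=
  [forall e in M, forall f in M, (e.1 == f.1) || (e.2 == f.2) ==> (e == f)].

Lemma matchingP n (M : {set 'I_n * 'I_n}) :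
  reflect (forall e f, e \in M -> f \in M -> e.1 = f.1 \/ e.2 = f.2 -> e = f)
          (matching M).
Proof.
apply: (iffP forall_inP) => [H e f eM fM ef|H e eM].
  have /forall_inP/(_ f fM)/implyP/(_ _)/eqP-> // := H e eM.
  by apply/orP; case: ef => ->; rewrite eqxx; [left|right].
apply/forall_inP => f fM; apply/implyP => /orP ef; apply/eqP/H => //.
by case: ef => /eqP; [left|right].
Qed.

Definition maximal_matching n (G M : {set 'I_n * 'I_n}) : Prop :=
  [/\ matching M, M \subset G &
    forall e, e \in G -> exists2 f, f \in M & f.1 = e.1 \/ f.2 = e.2].

Definition no_nested n (G : {set 'I_n * 'I_n}) :=
  forall a b : 'I_n, a != b -> exists z, ((a, z) \in G) && ((b, z) \notin G).

Section DoubleStar.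
Variables (n : nat) (E : {set 'I_n * 'I_n}).
Let G := (~: E)%SET.

(** The double star of [m = (c, c')] is reversed by the linear order whose
consecutive blocks are: the elements of A comparable with [c'], then [c'], the
other elements of A, the elements of A' incomparable with [c], then [c], and
the other elements of A'. *)
Definition star_block (m : 'I_n * 'I_n) (x : bipartite E) : nat :=
  match x with
  | inl a => if a == m.1 then 4 else if (a, m.2) \in E then 0 else 2
  | inr b => if b == m.2 then 1 else if (m.1, b) \in E then 5 else 3
  end%N.

Definition star_key (m : 'I_n * 'I_n) (x : bipartite E) : nat :=
  (star_block m x * #|{: bipartite E}| + enum_rank x)%N.

Definition star_order (m : 'I_n * 'I_n) : rel (bipartite E) :=
  fun x y => (star_key m x <= star_key m y)%N.

Lemma star_order_block m x y :
  (star_block m x < star_block m y)%N -> ~~ star_order m y x.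
Proof.
move=> lt; rewrite /star_order -ltnNge /star_key.
apply: (@leq_trans (star_block m x * #|{: bipartite E}| + #|{: bipartite E}|)%N).
  by rewrite ltn_add2l; exact: ltn_ord.
rewrite addnC -mulSn; apply: leq_trans (leq_addr _ _).
by rewrite leq_mul2r lt orbT.
Qed.

Lemma star_order_total m : total (star_order m).
Proof. by move=> x y; exact: leq_total. Qed.

Lemma star_linear_extension m : m \in G -> linear_extension (star_order m).
Proof.
rewrite inE => mE; split.
- by move=> x; exact: leqnn.
- move=> x y /andP[xy yx]; have [lt|lt|e] := ltngtP (star_block m x) (star_block m y).
  + by have := star_order_block lt; rewrite yx.
  + by have := star_order_block lt; rewrite xy.
  have : star_key m x = star_key m y by apply/eqP; rewrite eqn_leq; apply/andP.
  by rewrite /star_key e => /addnI /ord_inj /enum_rank_inj.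
- by move=> y x z; exact: leq_trans.
- exact: star_order_total.
- move=> x y; rewrite /Order.le /= /bipartite_le.
  case/orP=> [/eqP-> |]; first exact: leqnn.
  case: x => // a; case: y => // b abE.
  suff lt : (star_block m (inl a) < star_block m (inr b))%N.
    have := star_order_total m (inl a : bipartite E) (inr b : bipartite E).
    by rewrite (negbTE (star_order_block lt)) orbF.
  rewrite /star_block; have [am|nam] := eqVneq a m.1.
    have -> : b == m.2 = false.
      by apply: contraNF mE => /eqP bm; rewrite [m]surjective_pairing -am -bm.
    by rewrite -am abE.
  have [bm|nbm] := eqVneq b m.2; first by rewrite -bm abE.
  by case: ifP => _; case: ifP.
Qed.

(** A pair of [G] has an endpoint that is matched by maximality, and the double
star at that endpoint reverses it; an extension whose double star avoids both
endpoints does not. For [a], [b] in A, the double star centred at [a] puts [a]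
above [b]. If [a] is unmatched, then an element [z] that is adjacent to [a] but
not to [b] is matched, and the double star centred at [z] does it. *)
Lemma maximal_matching_realizes (M : {set 'I_n * 'I_n}) :
  maximal_matching G M -> (2 < #|M|)%N -> no_nested G -> no_nested (transpose G) ->
  realizable (bipartite E) #|M|.
Proof.
move=> [/matchingP Mm MG Mmax] M3 nn nn'.
rewrite /realizable (ltn_trans _ M3) //=; apply/asboolP.
exists (fun j => star_order (enum_val j)); split=> [j|x y].
  by apply: star_linear_extension; apply: (fintype.subsetP MG); exact: enum_valP.
split=> [xy j|H].
  have [_ _ _ _] := star_linear_extension (fintype.subsetP MG _ (enum_valP j)).
  exact.
apply/negPn/negP => nxy.
suff [m mM lt] : exists2 m, m \in M & (star_block m y < star_block m x)%N.
  have := H (enum_rank_in mM m); rewrite enum_rankK_in //.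
  by apply/negP; exact: star_order_block.
have nG e : e \in M -> e \notin E.
  by move=> /(fintype.subsetP MG); rewrite inE.
move: nxy; rewrite /Order.le /= /bipartite_le negb_or {H}.
case: x => [a|a']; case: y => [b|b'] /andP[nxy Exy].
- have {}nxy : a != b by apply: contra nxy => /eqP->.
  have [/existsP[m /andP[mM /eqP am]]|una] := boolP [exists m in M, m.1 == a].
    exists m => //; rewrite /star_block am eqxx (negbTE (_ : b != a)) 1?eq_sym //.
    by case: ifP.
  have [z /andP[]] := nn a b nxy; rewrite !inE negbK => azG bzE.
  have [|m mM] := Mmax (a, z); first by rewrite inE.
  move=> /= [ma|mz]; first by case/existsP: una; exists m; rewrite mM ma eqxx.
  exists m => //; rewrite /star_block mz bzE (negbTE azG).
  have -> : b == m.1 = false.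
    by apply: contraNF (nG _ mM) => /eqP bm; rewrite [m]surjective_pairing -bm mz.
  by case: ifP.
- have abG : (a, b') \in G by rewrite inE.
  have [m mM /= [ma|mb]] := Mmax _ abG; exists m => //.
    by rewrite /star_block ma eqxx (negbTE Exy); case: ifP.
  by rewrite /star_block mb eqxx (negbTE Exy); case: ifP.
- have [e eM /andP[e1 e2]] : exists2 e, e \in M & (e.1 != b) && (e.2 != a').
    apply/exists_inP; rewrite -[[exists _ in _, _]]negbK negb_exists_in.
    apply/negP => /forall_inP Mbad.
    pose f (e : 'I_n * 'I_n) := e.1 == b.
    have : (#|M| <= #|{: bool}|)%N.
      apply: (@leq_card_in _ _ f) => e1 e2 e1M e2M; rewrite /f => ef.
      apply: Mm => //; move: ef (Mbad _ e1M) (Mbad _ e2M).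
      case: eqVneq => [->|_]; case: eqVneq => [->|_] //= _; first by left.
      by rewrite !negbK => /eqP -> /eqP ->; right.
    by rewrite card_bool leqNgt M3.
  exists e => //; rewrite /star_block (eq_sym b) (eq_sym a') (negbTE e1) (negbTE e2).
  by case: ifP => _; case: ifP.
- have {}nxy : a' != b' by apply: contra nxy => /eqP->.
  have [/existsP[m /andP[mM /eqP bm]]|unb] := boolP [exists m in M, m.2 == b'].
    exists m => //; rewrite /star_block bm eqxx (negbTE nxy).
    by case: ifP.
  have [|z] := nn' b' a'; first by rewrite eq_sym.
  rewrite !in_transpose !inE negbK => /andP[zbG zaE].
  have [|m mM] := Mmax (z, b'); first by rewrite inE.
  move=> /= [mz|mb]; last by case/existsP: unb; exists m; rewrite mM mb eqxx.
  exists m => //; rewrite /star_block mz zaE (negbTE zbG).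
  have -> : a' == m.2 = false.
    by apply: contraNF (nG _ mM) => /eqP bm; rewrite [m]surjective_pairing -bm mz.
  by case: ifP.
Qed.

End DoubleStar.

(** * Small maximal matchings *)

Definition no_hole n (G : {set 'I_n * 'I_n}) (r z : nat) :=
  forall S T : {set 'I_n}, (r <= #|S|)%N -> (z <= #|T|)%N ->
  ~~ [disjoint finset.setX S T & G].

Lemma no_holeP n (G : {set 'I_n * 'I_n}) r z (S T : {set 'I_n}) :
  no_hole G r z -> (forall a b, a \in S -> b \in T -> (a, b) \notin G) ->
  (r <= #|S|)%N -> (#|T| < z)%N.
Proof.
move=> nh H rS; rewrite ltnNge; apply/negP => zT.
case/negP: (nh S T rS zT); apply/pred0P => -[a b] /=; rewrite finset.in_setX /=.
by apply/negP => /andP[/andP[/H h /h]] /negP.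
Qed.

Lemma no_hole_sym n (G : {set 'I_n * 'I_n}) r z (S T : {set 'I_n}) :
  no_hole (transpose G) r z -> (forall a b, a \in S -> b \in T -> (a, b) \notin G) ->
  (r <= #|T|)%N -> (#|S| < z)%N.
Proof.
move=> nh H; apply: no_holeP nh _ => a b aT bS.
by rewrite in_transpose H.
Qed.

Lemma matching_card1 n (M : {set 'I_n * 'I_n}) : matching M ->
  #|[set e.1 | e in M]%SET| = #|M|.
Proof. by move/matchingP => H; rewrite card_in_imset // => e f eM fM ef; apply: H; auto. Qed.

Lemma matching_card2 n (M : {set 'I_n * 'I_n}) : matching M ->
  #|[set e.2 | e in M]%SET| = #|M|.
Proof. by move/matchingP => H; rewrite card_in_imset // => e f eM fM ef; apply: H; auto. Qed.

Lemma matching_add n (M : {set 'I_n * 'I_n}) a b : matching M ->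
  a \notin [set e.1 | e in M]%SET -> b \notin [set e.2 | e in M]%SET ->
  matching ((a, b) |: M)%SET /\ #|((a, b) |: M)%SET| = #|M|.+1.
Proof.
move=> /matchingP Mm na nb; split; last first.
  by rewrite cardsU1 (_ : _ \notin M) //; apply: contra na => /(imset_f fst).
have new f : f \in M -> (a = f.1 \/ b = f.2) -> False.
  move=> fM [ea|eb]; first by move: na; rewrite ea imset_f.
  by move: nb; rewrite eb imset_f.
apply/matchingP => e f; rewrite !inE.
case/predU1P => [->|eM] /predU1P[->|fM] //= ef.
- by case: (new f fM).
- by case: (new e eM); case: ef => ->; [left|right].
- exact: Mm.
Qed.

Lemma matching_sub n (M M' : {set 'I_n * 'I_n}) :
  M' \subset M -> matching M -> matching M'.
Proof.
move=> /fintype.subsetP s /matchingP Mm; apply/matchingP => e f /s eM /s fM.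
exact: Mm.
Qed.

(** Let [M] be a maximum matching and [S], [S'] its unmatched sets, both of size at
least [r]. Fewer than [z] vertices have no neighbour in [S], fewer than [z] have
none in [S'], and [M] has at least [2 z] edges, so some edge of [M] has both
endpoints adjacent to the unmatched sets. It can be exchanged for two
edges. *)
Lemma max_matching_deficit n (G : {set 'I_n * 'I_n}) (C C' : {set 'I_n}) r z :
  no_hole G r z -> no_hole (transpose G) r z ->
  #|C| = #|C'| -> (3 * z <= #|C|)%N ->
  exists M : {set 'I_n * 'I_n}, [/\ matching M,
    M \subset (G :&: finset.setX C C')%SET & (#|C| < #|M| + r)%N].
Proof.
move=> nh nh' CC' zC.
pose P (M : {set 'I_n * 'I_n}) := matching M && (M \subset (G :&: finset.setX C C')%SET).
have P0 : P finset.set0.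
  by rewrite /P finset.sub0set andbT; apply/matchingP => e f; rewrite inE.
case: (arg_maxnP (fun M : {set 'I_n * 'I_n} => #|M|) P0) => M /andP[mM sM] Mmax0.
have Mmax N : P N -> (#|N| <= #|M|)%N by exact: Mmax0.
exists M; split=> //.
pose S := (C :\: [set e.1 | e in M])%SET; pose S' := (C' :\: [set e.2 | e in M])%SET.
have MC e : e \in M -> [/\ e \in G, e.1 \in C & e.2 \in C'].
  by move/(fintype.subsetP sM); rewrite !inE => /and3P[].
have sub1 : [set e.1 | e in M]%SET \subset C.
  by apply/fintype.subsetP => _ /imsetP[e /MC[_ h _] ->].
have sub2 : [set e.2 | e in M]%SET \subset C'.
  by apply/fintype.subsetP => _ /imsetP[e /MC[_ _ h] ->].
have cS : (#|S| + #|M| = #|C|)%N.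
  by rewrite cardsDS // matching_card1 // subnK // -(matching_card1 mM) subset_leq_card.
have cS' : (#|S'| + #|M| = #|C|)%N.
  by rewrite cardsDS // matching_card2 // CC' subnK // -(matching_card2 mM) subset_leq_card.
rewrite -cS addnC ltn_add2l ltnNge; apply/negP => rS.
have rS' : (r <= #|S'|)%N by rewrite -(leq_add2r #|M|) cS' -cS leq_add2r.
have extend a b (N : {set 'I_n * 'I_n}) : matching N -> N \subset (G :&: finset.setX C C')%SET ->
    a \in C :\: [set e.1 | e in N]%SET -> b \in C' :\: [set e.2 | e in N]%SET ->
    (a, b) \in G -> P ((a, b) |: N)%SET /\ #|((a, b) |: N)%SET| = #|N|.+1.
  move=> mN sN; rewrite !inE => /andP[na aC] /andP[nb bC'] abG.
  have [h1 ->] := matching_add mN na nb; split=> //; rewrite /P h1 /=.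
  apply/fintype.subsetP => e; rewrite finset.in_setU1 => /predU1P[->|/(fintype.subsetP sN)//].
  by rewrite !inE abG aC.
have SS' a b : a \in S -> b \in S' -> (a, b) \notin G.
  move=> aS bS'; apply/negP => abG; have [PM cM] := extend a b M mM sM aS bS' abG.
  by have := Mmax _ PM; rewrite cM ltnn.
have Sz : (#|S'| < z)%N := no_holeP nh SS' rS.
have zM : (z + z <= #|M|)%N.
  rewrite -(leq_add2l #|S'|) cS'; apply: leq_trans zC.
  by rewrite mulSn mul2n addnn leq_add2r ltnW.
pose W := [set x | [forall u in S', (x, u) \notin G]]%SET.
pose W' := [set x | [forall u in S, (u, x) \notin G]]%SET.
have Wz : (#|W| < z)%N.
  apply: (no_hole_sym nh' _ rS') => a b; rewrite inE => /forall_inP h /h.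
  exact.
have Wz' : (#|W'| < z)%N.
  by apply: (no_holeP nh _ rS) => a b aS; rewrite inE => /forall_inP /(_ _ aS).
have [e eM /andP[e1 e2]] : exists2 e, e \in M & (e.1 \notin W) && (e.2 \notin W').
  apply/exists_inP; rewrite -[[exists _ in _, _]]negbK negb_exists_in.
  apply/negP => /forall_inP bad.
  have MW : M \subset ([set e in M | e.1 \in W] :|: [set e in M | e.2 \in W'])%SET.
    apply/fintype.subsetP => e eM; rewrite !inE eM /=.
    by have := bad e eM; rewrite negb_and !negbK !inE.
  have c1 : (#|[set e in M | e.1 \in W]%SET| <= #|W|)%N.
    rewrite -(matching_card1 (matching_sub _ mM)); last first.
      by apply/fintype.subsetP => f; rewrite inE => /andP[].
    apply/subset_leq_card/fintype.subsetP => x /imsetP[f]; rewrite inE => /andP[_ h] ->.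
    exact: h.
  have c2 : (#|[set e in M | e.2 \in W']%SET| <= #|W'|)%N.
    rewrite -(matching_card2 (matching_sub _ mM)); last first.
      by apply/fintype.subsetP => f; rewrite inE => /andP[].
    apply/subset_leq_card/fintype.subsetP => x /imsetP[f]; rewrite inE => /andP[_ h] ->.
    exact: h.
  have : (#|M| <= #|W| + #|W'|)%N.
    apply: leq_trans (subset_leq_card MW) _.
    by apply: leq_trans (leq_card_setU _ _) _; exact: leq_add.
  apply/negP; rewrite -ltnNge; apply: leq_trans zM.
  by rewrite -addSn leq_add // ltnW.
move: e1 e2; rewrite !inE => /forall_inPn[u' u'S' /negPn e1u'] /forall_inPn[u uS /negPn ue2].
pose N := (M :\ e)%SET.
have sNM : N \subset M by exact: subD1set.
have mN := matching_sub sNM mM; have sN := fintype.subset_trans sNM sM.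
have [eG e1C e2C] := MC e eM.
have e1N : e.1 \notin [set f.1 | f in N]%SET.
  apply/imsetP => -[f]; rewrite !inE => /andP[/eqP fe fM] ef; apply: fe.
  by apply: (matchingP _ mM) => //; left.
have e2N : e.2 \notin [set f.2 | f in N]%SET.
  apply/imsetP => -[f]; rewrite !inE => /andP[/eqP fe fM] ef; apply: fe.
  by apply: (matchingP _ mM) => //; right.
have [uM uC] : u \notin [set f.1 | f in M]%SET /\ u \in C by move: uS; rewrite inE => /andP.
have [uM' uC'] : u' \notin [set f.2 | f in M]%SET /\ u' \in C' by move: u'S'; rewrite inE => /andP.
have [||/andP[mN1 sN1] cN1] := extend u e.2 N mN sN _ _ ue2.
- by rewrite inE uC andbT; apply: contra uM; exact: (fintype.subsetP (imsetS _ sNM)).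
- by rewrite inE e2N.
have [||PN2 cN2] := extend e.1 u' _ mN1 sN1 _ _ e1u'.
- rewrite inE e1C andbT; apply/imsetP => -[f]; rewrite !inE => /predU1P[->|fN] /=.
    by move=> eu; move: uM; rewrite -eu imset_f.
  by move=> ef; move: e1N; rewrite ef imset_f // /N !inE.
- rewrite inE uC' andbT; apply/imsetP => -[f]; rewrite !inE => /predU1P[->|fN] /=.
    by move=> eu; move: uM'; rewrite eu imset_f.
  move=> ef; move: uM'; rewrite ef imset_f //.
  by case/andP: fN.
have := Mmax _ PN2; rewrite cN2 cN1 /N [in X in (_ <= X)%N -> _](cardsD1 e M) eM.
by rewrite ltnn.
Qed.

(** A maximum matching off [B] and [B'] is extended to a maximal one. Every edge has
its first end outside [B], or it joins [B] to a vertex outside [B'] that the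
maximum matching misses, of which there are fewer than [r]. *)
Lemma small_maximal_matching n (G : {set 'I_n * 'I_n}) (B B' : {set 'I_n}) r z :
  no_hole G r z -> no_hole (transpose G) r z ->
  #|B| = #|B'| -> (3 * z <= n - #|B|)%N ->
  [disjoint finset.setX B B' & G] ->
  exists2 M, maximal_matching G M
    & (n - #|B| < #|M| + r)%N && (#|M| < n - #|B| + r)%N.
Proof.
move=> nh nh' BB' zB dBB.
have cC (S : {set 'I_n}) : #|~: S|%SET = (n - #|S|)%N by rewrite cardsCs finset.setCK card_ord.
have [||M0 [mM0 sM0 cM0]] := @max_matching_deficit n G (~: B)%SET (~: B')%SET r z nh nh'.
- by rewrite !cC BB'.
- by rewrite cC.
rewrite cC in cM0.
pose P (M : {set 'I_n * 'I_n}) := [&& matching M, M \subset G & M0 \subset M].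
have P0 : P M0.
  rewrite /P mM0 fintype.subxx andbT; apply: fintype.subset_trans sM0 _; exact: finset.subsetIl.
case: (arg_maxnP (fun M : {set 'I_n * 'I_n} => #|M|) P0) => M /and3P[mM sM s0M] Mmax0.
have Mmax N : P N -> (#|N| <= #|M|)%N by exact: Mmax0.
exists M.
  split=> // -[a b] abG.
  have [/exists_inP[f fM /orP h]|none] :=
      boolP [exists f in M, (f.1 == a) || (f.2 == b)].
    by exists f => //; case: h => /eqP; [left|right].
  have [||mM1 cM1] := @matching_add _ M a b mM.
  - apply/imsetP => -[f fM af]; case/negP: none; apply/exists_inP; exists f => //.
    by rewrite af eqxx.
  - apply/imsetP => -[f fM af]; case/negP: none; apply/exists_inP; exists f => //.
    by rewrite af eqxx orbT.
  have /Mmax : P ((a, b) |: M)%SET.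
    rewrite /P mM1 finset.subUset finset.sub1set abG sM /=.
    exact: fintype.subset_trans s0M (finset.subsetUr _ _).
  by rewrite cM1 ltnn.
apply/andP; split.
  by apply: leq_trans cM0 _; rewrite leq_add2r subset_leq_card.
(* The edges that start in [B], all of them new. *)
pose F := [set e : 'I_n * 'I_n | e.1 \in B]%SET.
have MG e : e \in M -> e \in G by exact: (fintype.subsetP sM).
rewrite -(cardsID F M) addnC -addnS; apply: leq_add.
  rewrite -(matching_card1 (matching_sub _ mM)) ?finset.subsetDl // -cC.
  apply/subset_leq_card/fintype.subsetP => x /imsetP[e]; rewrite !inE => /andP[h _] ->.
  exact: h.
rewrite -(matching_card2 (matching_sub _ mM)) ?finset.subsetIl //.
have sub2 : [set e.2 | e in M0]%SET \subset (~: B')%SET.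
  apply/fintype.subsetP => x /imsetP[e /(fintype.subsetP sM0)].
  by rewrite !inE => /and3P[_ _ h] ->.
apply: (@leq_ltn_trans #|(~: B' :\: [set e.2 | e in M0])%SET|); last first.
  have le : (#|M0| <= n - #|B'|)%N.
    by rewrite -cC -(matching_card2 mM0) subset_leq_card.
  by rewrite cardsDS // matching_card2 // cC ltn_subLR // -BB'.
apply/subset_leq_card/fintype.subsetP => x /imsetP[e]; rewrite !inE => /andP[eM eB] ->.
apply/andP; split.
  apply/imsetP => -[f fM0 ef].
  have := matchingP _ mM e f eM (fintype.subsetP s0M _ fM0) (or_intror ef) => e_f.
  by have := fintype.subsetP sM0 _ fM0; rewrite -e_f !inE eB andbF.
apply/negP => eB'; have := disjointFl dBB (MG _ eM).
by rewrite !inE eB eB'.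
Qed.

(** * Tail bounds *)

Section Tails.
Variables (R : realType) (n : nat) (p : R).
Hypotheses (p0 : 0 <= p) (p1 : p <= 1).
Let q := 1 - p.
Implicit Types (E S T : {set 'I_n * 'I_n}).

Let q0 : 0 <= q. Proof. by rewrite subr_ge0. Qed.

Lemma pow_1D_le (x : R) k : - 1 <= x -> (1 + x) ^+ k <= expR (k%:R * x).
Proof.
move=> x1; rewrite expRM_natl lerXn2r ?nnegrE ?expR_ge0 ?expR_ge1Dx //.
by rewrite -lerBlDl sub0r.
Qed.

Lemma pow2_le_expR k : 2 ^+ k <= expR k%:R :> R.
Proof. by have := @pow_1D_le 1 k; rewrite mulr1; apply; lra. Qed.

(** From [1 - x <= expR (- x)] at [x = 5/32], as [(27/32)^4 >= 1/2]. *)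
Lemma two_ge_expR : expR (5 / 8) <= 2 :> R.
Proof.
have h : 27 / 32 <= expR (- (5 / 32)) :> R.
  by apply: le_trans (expR_ge1Dx _); lra.
have h4 : (27 / 32) ^+ 4 <= expR (- (5 / 8)) :> R.
  have -> : - (5 / 8) = 4%:R * - (5 / 32) :> R by field.
  by rewrite expRM_natl lerXn2r // nnegrE; [lra|exact: expR_ge0].
have h2 : 2^-1 <= expR (- (5 / 8)) :> R by apply: le_trans h4; lra.
by rewrite -[expR _]invrK -expRN -[leRHS]invrK lef_pV2 ?posrE ?expR_gt0 ?invr_gt0.
Qed.

Lemma exp2_ge_expR (x : R) k : x <= k%:R -> expR (5 / 8 * x) <= 2 ^+ k.
Proof.
move=> xk; apply: (@le_trans _ _ (expR (5 / 8) ^+ k)).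
  by rewrite -expRM_natl ler_expR mulrC ler_wpM2r //; lra.
by rewrite lerXn2r ?nnegrE ?expR_ge0 // two_ge_expR.
Qed.

(** From [1 + x <= expR x] at [x = 23/400], as [(423/400)^4 >= 5/4]. *)
Lemma four_fifths_ge_expR : expR (- (23 / 100)) <= 4 / 5 :> R.
Proof.
have h : 423 / 400 <= expR (23 / 400) :> R.
  by apply: le_trans (expR_ge1Dx _); lra.
have h4 : (423 / 400) ^+ 4 <= expR (23 / 100) :> R.
  have -> : 23 / 100 = 4%:R * (23 / 400) :> R by field.
  by rewrite expRM_natl lerXn2r // nnegrE; [lra|exact: expR_ge0].
have h2 : 5 / 4 <= expR (23 / 100) :> R by apply: le_trans h4; lra.
by rewrite expRN -[leRHS]invrK lef_pV2 ?posrE ?expR_gt0 //; lra.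
Qed.

(** Markov's inequality for [(4/5)^X], where [X] is the number of incomparable pairs
in [S]: the expectation is [(1 - q/5)^|S|], and [5/6 * 23/100 < 1/5]. *)
Lemma Pr_few_incomparable S :
  Pr_Omega p (fun E => #|S :\: E|%SET%:R <= 5 / 6 * (q * #|S|%:R))
    <= expR (- (q * #|S|%:R / 120)).
Proof.
pose f E : R := \prod_(e in S) (if e \in E then 1 else 4 / 5).
have fE E : f E = (4 / 5) ^+ #|S :\: E|%SET.
  rewrite -prodr_const [LHS]big_mkcond [RHS]big_mkcond; apply: eq_bigr => e _.
  by rewrite !inE; case: (e \in S); case: (e \in E).
set x := q * _.
apply: le_trans (@Pr_markov _ _ _ p0 p1 _ f (expR (- (23 / 100 * (5 / 6 * x))))
  (expR_gt0 _) _ _) _.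
- by move=> E; rewrite fE exprn_ge0 //; lra.
- move=> E le; rewrite fE.
  apply: (@le_trans _ _ (expR (- (23 / 100)) ^+ #|S :\: E|%SET)).
    by rewrite -expRM_natl ler_expR mulrN lerN2 mulrC ler_wpM2l //; lra.
  by rewrite lerXn2r ?nnegrE ?expR_ge0 ?four_fifths_ge_expR //; lra.
rewrite /f Ex_exp -expRN opprK.
apply: (@le_trans _ _ (expR (23 / 100 * (5 / 6 * x)) * expR (- (x / 5)))).
  rewrite ler_wpM2l ?expR_ge0 //.
  have -> : p * 1 + (1 - p) * (4 / 5) = 1 + - (q / 5) by rewrite /q; field.
  apply: le_trans (pow_1D_le _ _) _; first by rewrite /q; have := p0; lra.
  by rewrite ler_expR /x mulrN lerN2 mulrA [_ * q]mulrC.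
by rewrite -expRD ler_expR; lra.
Qed.

(** The binomial expansion of the right side, where some subsets are omitted. *)
Lemma sum_subsets_le (W : {set 'I_n * 'I_n}) (P : pred {set 'I_n * 'I_n}) (x : R) :
  0 <= x -> (forall T, P T -> T \subset W) ->
  \sum_(T | P T) x ^+ #|T| <= (1 + x) ^+ #|W|.
Proof.
move=> x0 PW; pose F (e : 'I_n * 'I_n) : R := if e \in W then x else 0.
have -> : (1 + x) ^+ #|W| = \sum_(T : {set 'I_n * 'I_n}) \prod_(e in T) F e.
  rewrite -prodr_const big_mkcond /= (eq_bigr (fun e => F e + 1)).
    by rewrite bigA_distr; apply: eq_bigr => T _; rewrite -big_mkcond.
  by move=> e _; rewrite /F; case: ifP; rewrite ?add0r // addrC.
rewrite [leLHS]big_mkcond; apply: ler_sum => T _; case: ifP => PT.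
  rewrite -prodr_const le_eqVlt; apply/orP; left; apply/eqP.
  by apply: eq_bigr => e /(fintype.subsetP (PW T PT)); rewrite /F => ->.
by apply: prodr_ge0 => e _; rewrite /F; case: ifP.
Qed.

(** [2 ^ #|X|] counts the subsets of the set [X] of echoes. Choosing a witness
[(c, b')] for each echo [(phi c, b')] embeds these subsets into the good sets
[T] of witnesses for which all the pairs [(c, b')] and [(phi c, b')] are
incomparable. These are [2 #|T|] different pairs, as [c] is outside [B] and
[phi c] is in [B]. *)
Lemma Ex_pow_echoes (phi : {ffun 'I_n -> 'I_n}) (B B' : {set 'I_n}) :
  Ex p (fun E => 2 ^+ #|echoes (~: E)%SET phi B B'|)
    <= (1 + q ^+ 2) ^+ (n * #|B'|).
Proof.
(* From a witness back to the echo. *)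
pose sg (e : 'I_n * 'I_n) := (phi e.1, e.2).
pose good T := [&& T \subset finset.setX (~: B)%SET B',
  [forall e in T, phi e.1 \in B] & [forall e in T, forall f in T, (sg e == sg f) ==> (e == f)]].
pose S T := (T :|: sg @: T)%SET.
have goodP T : good T -> [/\ T \subset finset.setX (~: B)%SET B',
    forall e, e \in T -> phi e.1 \in B & {in T &, injective sg}].
  case/and3P=> h1 /forall_inP h2 /forall_inP h3; split=> // e f eT fT ef.
  have /forall_inP/(_ f fT)/implyP/(_ _)/eqP := h3 e eT; apply.
  by rewrite ef.
have cS T : good T -> #|S T| = (2 * #|T|)%N.
  case/goodP=> h1 h2 h3; rewrite /S cardsU card_in_imset // mul2n -addnn.
  rewrite (_ : (T :&: _)%SET = finset.set0) ?cards0 ?subn0 //.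
  apply/finset.setP => e; rewrite !inE; apply/negbTE/negP => /andP[eT /imsetP[f fT ef]].
  have := fintype.subsetP h1 _ eT; rewrite ef !inE /=.
  by rewrite (h2 _ fT).
have step E : 2 ^+ #|echoes (~: E)%SET phi B B'|
    <= \sum_(T | good T) ([disjoint S T & E])%:R :> R.
  set X := echoes _ _ _ _.
  pose rho (e : 'I_n * 'I_n) := (odflt e.1 [pick c | [&& c \notin B, phi c == e.1
      & (c, e.2) \in (~: E)%SET]], e.2).
  have rhoX e : e \in X -> [/\ (rho e).1 \notin B, phi (rho e).1 = e.1,
      (rho e) \in (~: E)%SET & sg (rho e) = e].
    rewrite inE => /and4P[_ eB eB' /existsP[c hc]].
    rewrite /rho /sg; case: pickP => [d /and3P[dB /eqP pd dE]|/(_ c)]; last by rewrite hc.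
    by rewrite /= pd -surjective_pairing.
  have sgK (Y : {set 'I_n * 'I_n}) : Y \subset X -> [set sg e | e in [set rho e | e in Y]]%SET = Y.
    move=> /fintype.subsetP YX; rewrite -imset_comp -[RHS]imset_id.
    by apply: eq_in_imset => e /YX /rhoX [].
  rewrite -natrX -card_powerset -(card_in_imset (f := fun Y : {set 'I_n * 'I_n} => [set rho e | e in Y]%SET)); last first.
    move=> Y Z; rewrite !finset.powersetE => YX ZX e.
    by rewrite -(sgK Y YX) -(sgK Z ZX) e.
  rewrite -natr_sum ler_nat -sum1_card.
  rewrite [leqRHS](_ : _ = \sum_(T | good T && [disjoint S T & E]) 1)%N; last first.
    by rewrite [RHS]big_mkcondr; apply: eq_bigr => T _; case: ifP.
  rewrite !sum1_card; apply/subset_leq_card/fintype.subsetP => T /imsetP[Y].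
  rewrite finset.powersetE => YX -> {T}.
  have YP e : e \in Y -> e \in X by exact: (fintype.subsetP YX).
  rewrite unfold_in; apply/andP; split; [apply/and3P; split|].
  - apply/fintype.subsetP => _ /imsetP[e /YP eX ->]; have [h _ _ _] := rhoX e eX.
    by move: eX; rewrite !inE h => /and4P[].
  - apply/forall_inP => _ /imsetP[e /YP eX ->]; have [_ -> _ _] := rhoX e eX.
    by move: eX; rewrite !inE => /and4P[].
  - apply/forall_inP => _ /imsetP[e /YP eX ->].
    apply/forall_inP => _ /imsetP[f /YP fX ->]; apply/implyP.
    by have [_ _ _ ->] := rhoX e eX; have [_ _ _ ->] := rhoX f fX => /eqP ->.
  rewrite /S sgK // finset.disjoints_subset finset.subUset; apply/andP; split.
    by apply/fintype.subsetP => _ /imsetP[e /YP /rhoX[_ _ h _] ->].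
  by apply/fintype.subsetP => e /YP; rewrite inE => /andP[].
apply: le_trans (Ex_le p0 p1 step) _; rewrite Ex_sum.
rewrite (eq_bigr (fun T => (q ^+ 2) ^+ #|T|)); last first.
  by move=> T gT; rewrite -Pr_OmegaE Pr_avoid // cS // exprM.
rewrite (_ : (n * _)%N = #|finset.setX [set: 'I_n] B'|%SET); last first.
  by rewrite cardsX cardsT card_ord.
apply: sum_subsets_le; first exact: exprn_ge0.
move=> T /goodP[h _ _]; apply: fintype.subset_trans h _.
by apply: finset.setXS => //; exact: finset.subsetT.
Qed.

Lemma Pr_many_echoes (phi : {ffun 'I_n -> 'I_n}) (B B' : {set 'I_n}) :
  Pr_Omega p (fun E => 2 * (q ^+ 2 * (n%:R * #|B'|%:R))
      <= #|echoes (~: E)%SET phi B B'|%:R)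
    <= expR (- (q ^+ 2 * (n%:R * #|B'|%:R) / 4)).
Proof.
set mu := q ^+ 2 * _.
apply: le_trans (@Pr_markov _ _ _ p0 p1 _ (fun E => 2 ^+ #|echoes (~: E)%SET phi B B'|)
  (expR (5 / 8 * (2 * mu))) (expR_gt0 _) _ _) _.
- by move=> E; exact: exprn_ge0.
- by move=> E; exact: exp2_ge_expR.
apply: (@le_trans _ _ (expR (- (5 / 8 * (2 * mu))) * expR mu)).
  rewrite expRN ler_wpM2l ?invr_ge0 ?expR_ge0 //.
  apply: le_trans (Ex_pow_echoes _ _ _) _.
  apply: le_trans (pow_1D_le _ _) _; first by apply: le_trans (exprn_ge0 _ q0); lra.
  by rewrite natrM /mu [X in _ <= expR X]mulrC.
by rewrite -expRD ler_expR; lra.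
Qed.

Definition codegree E (U : {set 'I_n}) : nat :=
  #|[set b | [forall u in U, (u, b) \notin E]]%SET|.

(** Markov's inequality for [2] to the power of the codegree, a product over the
columns. *)
Lemma Pr_large_codegree (U : {set 'I_n}) :
  Pr_Omega p (fun E => 5 / 3 * (n%:R * q ^+ #|U|) <= (codegree E U)%:R)
    <= expR (- (n%:R * q ^+ #|U| / 24)).
Proof.
set mu := n%:R * _.
pose f E : R := \prod_(b < n) (1 + 1 * [forall u in U, (u, b) \notin E]%:R
           * [forall v in (finset.set0 : {set 'I_n}), (v, b) \in E]%:R).
have fE E : f E = 2 ^+ codegree E U.
  rewrite -prodr_const big_mkcond; apply: eq_bigr => b _; rewrite inE.
  rewrite (_ : [forall v in finset.set0, _] = true); last first.
    by apply/forall_inP => v; rewrite inE.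
  by case: ifP; rewrite ?mulr1 ?mul1r ?mulr0 ?addr0.
apply: le_trans (@Pr_markov _ _ _ p0 p1 _ f (expR (5 / 8 * (5 / 3 * mu))) (expR_gt0 _) _ _) _.
- by move=> E; rewrite fE exprn_ge0.
- by move=> E; rewrite fE; exact: exp2_ge_expR.
apply: (@le_trans _ _ (expR (- (5 / 8 * (5 / 3 * mu))) * expR mu)).
  rewrite expRN ler_wpM2l ?invr_ge0 ?expR_ge0 // /f Ex_columns; last first.
    by rewrite disjoint_sym finset.disjoints_subset finset.sub0set.
  rewrite cards0 expr0 mulr1 mul1r.
  apply: le_trans (pow_1D_le _ _) _ => //.
  by apply: le_trans (exprn_ge0 _ q0); lra.
by rewrite -expRD ler_expR; lra.
Qed.

(** Markov's inequality for [2] to the power of minus the number of columns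
entirely above [V]. *)
Lemma Pr_few_common_above (V : {set 'I_n}) (s : nat) :
  Pr_Omega p (fun E => (#|[set b | [forall v in V, (v, b) \in E]]%SET| <= s)%N)
    <= 2 ^+ s * expR (- (n%:R * (p ^+ #|V| / 2))).
Proof.
pose f E : R := \prod_(b < n) (1 + - 2^-1
   * [forall v in (finset.set0 : {set 'I_n}), (v, b) \notin E]%:R
   * [forall v in V, (v, b) \in E]%:R).
have fE E : f E = 2^-1 ^+ #|[set b | [forall v in V, (v, b) \in E]]%SET|.
  rewrite -prodr_const big_mkcond; apply: eq_bigr => b _; rewrite inE.
  rewrite (_ : [forall v in finset.set0, _] = true); last first.
    by apply/forall_inP => v; rewrite inE.
  by case: ifP => _; rewrite ?mulr1 ?mulr0 ?addr0 //; field.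
apply: le_trans (@Pr_markov _ _ _ p0 p1 _ f (2^-1 ^+ s) _ _ _) _.
- by rewrite exprn_gt0 // invr_gt0.
- by move=> E; rewrite fE exprn_ge0 // invr_ge0.
- by move=> E le; rewrite fE; apply: ler_wiXn2l => //; rewrite ?invr_ge0 ?invf_le1 //; lra.
rewrite -exprVn invrK ler_wpM2l ?exprn_ge0 // /f Ex_columns; last first.
  by rewrite finset.disjoints_subset finset.sub0set.
rewrite cards0 expr0 mulr1 mulNr.
apply: le_trans (pow_1D_le _ _) _.
  by have := exprn_ile1 #|V| p0 p1; have := exprn_ge0 #|V| p0; lra.
by rewrite ler_expR mulrN mulrC [2^-1 * _]mulrC mulrC.
Qed.

Lemma Pr_nested :
  Pr_Omega p (fun E => `[< ~ no_nested (~: E)%SET >])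
    <= n%:R ^+ 2 * expR (- (n%:R * (p * q))).
Proof.
pose P (i : 'I_n * 'I_n) := i.1 != i.2.
pose Q (i : 'I_n * 'I_n) E := ~~ [exists z, ((i.1, z) \notin E) && ((i.2, z) \in E)].
have := @Pr_union _ _ _ p0 p1 _ P (fun E => `[< ~ no_nested (~: E)%SET >]) Q
  (expR (- (n%:R * (p * q)))).
move=> /(_ _ _)/le_trans; apply.
- move=> E /asboolP /existsNP[a /existsNP[b]] /not_implyP[ab H].
  exists (a, b) => //; apply/negP => /existsP[z /= hz]; apply: H; exists z.
  by rewrite !inE negbK.
- move=> [a b]; rewrite /P /Q /= => ab.
  pose f E : R := \prod_(z < n) (1 + - 1
     * [forall u in [set a]%SET, (u, z) \notin E]%:R
     * [forall v in [set b]%SET, (v, z) \in E]%:R).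
  have s1 (c : 'I_n) (F : pred 'I_n) : [forall u in [set c]%SET, F u] = F c.
    by apply/forall_inP/idP => [/(_ c)|Fc u]; rewrite inE ?eqxx; [apply|move/eqP->].
  have fE E z : 1 + - 1
     * [forall u in [set a]%SET, (u, z) \notin E]%:R
     * [forall v in [set b]%SET, (v, z) \in E]%:R
     = (~~ (((a, z) \notin E) && ((b, z) \in E)))%:R :> R.
    rewrite (s1 a (fun u => (u, z) \notin E)) (s1 b (fun u => (u, z) \in E)).
    by case: (_ \in E); case: (_ \in E); rewrite /= ?mulr1 ?mulr0 ?addr0 ?subrr.
  apply: le_trans (@Pr_le _ _ _ p0 p1 _ f _ _) _.
  + by move=> E; apply: prodr_ge0 => z _; rewrite fE.
  + move=> E; rewrite negb_exists => /forallP h.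
    by rewrite /f big1 // => z _; rewrite fE h.
  rewrite /f Ex_columns; last first.
    by rewrite finset.disjoints_subset finset.sub1set !inE.
  rewrite !cards1 !expr1 !mulNr mul1r.
  apply: le_trans (pow_1D_le _ _) _.
    by rewrite lerN2 mulr_ile1 // /q; have := p0; lra.
  by rewrite mulrN [q * p]mulrC.
rewrite ler_wpM2r ?expR_ge0 // -natrX ler_nat.
by apply: leq_trans (max_card _) _; rewrite card_prod card_ord -mulnn.
Qed.

Lemma Pr_hole r z :
  Pr_Omega p (fun E => `[< ~ no_hole (~: E)%SET r z >])
    <= 4 ^+ n * expR (- (q * (r * z)%:R)).
Proof.
pose P (i : {set 'I_n} * {set 'I_n}) := (r <= #|i.1|)%N && (z <= #|i.2|)%N.
pose Q (i : {set 'I_n} * {set 'I_n}) E := finset.setX i.1 i.2 \subset E.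
have := @Pr_union _ _ _ p0 p1 _ P (fun E => `[< ~ no_hole (~: E)%SET r z >]) Q
  (expR (- (q * (r * z)%:R))).
move=> /(_ _ _)/le_trans; apply.
- move=> E /asboolP /existsNP[S /existsNP[T]] /not_implyP[rS] /not_implyP[zT H].
  exists (S, T); first by rewrite /P rS.
  by move/negP: H; rewrite negbK finset.disjoints_subset finset.setCK.
- move=> [S T] /andP[/= rS zT].
  have := @Pr_cylinder _ _ p finset.set0 (finset.setX S T).
  rewrite cards0 expr0 mul1r => H.
  have -> : Pr_Omega p (Q (S, T)) = p ^+ #|finset.setX S T|.
    rewrite -H; last by rewrite finset.disjoints_subset finset.sub0set.
    rewrite !Pr_OmegaE; apply: eq_Ex => E.
    by rewrite finset.disjoints_subset finset.sub0set.
  have -> : p = 1 + - q by rewrite /q; ring.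
  apply: le_trans (pow_1D_le _ _) _; first by rewrite lerN2 /q; have := p0; lra.
  rewrite ler_expR mulrN lerN2 mulrC ler_wpM2r // ler_nat cardsX.
  exact: leq_mul.
rewrite ler_wpM2r ?expR_ge0 // -natrX ler_nat.
apply: leq_trans (max_card _) _; rewrite card_prod -!cardsT -!finset.powersetT.
by rewrite !card_powerset cardsT card_ord -expnMn.
Qed.

(** The first moment, over pairs of injections of ['I_9]. *)
Lemma Pr_biclique9 :
  Pr_Omega p (fun E => `[< ~ biclique9_free (~: E)%SET >])
    <= n%:R ^+ 18 * q ^+ 81.
Proof.
pose P (i : {ffun 'I_9 -> 'I_n} * {ffun 'I_9 -> 'I_n}) := injectiveb i.1 && injectiveb i.2.
pose K (i : {ffun 'I_9 -> 'I_n} * {ffun 'I_9 -> 'I_n}) :=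
  finset.setX [set i.1 x | x in 'I_9]%SET [set i.2 x | x in 'I_9]%SET.
have := @Pr_union _ _ _ p0 p1 _ P (fun E => `[< ~ biclique9_free (~: E)%SET >])
  (fun i E => [disjoint K i & E]) (q ^+ 81).
move=> /(_ _ _)/le_trans; apply.
- move=> E /asboolP /existsNP[U /existsNP[U']] /not_implyP[c] /not_implyP[c' H].
  have inj (W : {set 'I_n}) : (8 < #|W|)%N -> exists2 f : {ffun 'I_9 -> 'I_n},
      injectiveb f & [set f x | x in 'I_9]%SET \subset W.
    move=> cW; exists [ffun x => enum_val (widen_ord cW x)].
      apply/injectiveP => x y; rewrite !ffunE => /enum_val_inj /(congr1 val) /= xy.
      exact: val_inj.
    by apply/fintype.subsetP => _ /imsetP[x _ ->]; rewrite ffunE enum_valP.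
  have [f fi fU] := inj U c; have [g gi gU] := inj U' c'.
  exists (f, g); first by rewrite /P fi gi.
  move/negP: H; rewrite negbK -finset.setCS finset.setCK finset.disjoints_subset => H.
  apply: fintype.subset_trans (finset.setXS fU gU) _.
  by rewrite -finset.setCS finset.setCK.
- move=> [f g] /andP[/= /injectiveP fi /injectiveP gi].
  by rewrite Pr_avoid // /K cardsX !card_imset // card_ord.
rewrite ler_wpM2r ?exprn_ge0 // -natrX ler_nat.
apply: leq_trans (max_card _) _; rewrite card_prod !card_ffun !card_ord.
by rewrite -expnD.
Qed.

End Tails.

(** * The lower bound *)

Lemma order_dimP (d : Order.disp_t) (T : finPOrderType d) :
  realizable T (order_dim T).
Proof. by rewrite /order_dim; case: ex_minnP. Qed.

Lemma order_dim_le (d : Order.disp_t) (T : finPOrderType d) k :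
  realizable T k -> (order_dim T <= k)%N.
Proof. by rewrite /order_dim; case: ex_minnP => m _ + h; apply. Qed.

Section LowerBound.
Variables (R : realType) (n : nat) (y : R).
Hypotheses (yn : n%:R = y ^+ 4) (y10 : 10 <= y) (ny : n%:R <= expR (y / 100)).
Let q := y^-1.
Let p := 1 - q.
Implicit Types (E : {set 'I_n * 'I_n}).

Let y0 : 0 < y. Proof. by apply: lt_le_trans y10. Qed.
Let q0 : 0 < q. Proof. by rewrite invr_gt0. Qed.
Let qy : q * y = 1. Proof. by rewrite mulVf // gt_eqF. Qed.
Let p0 : 0 <= p.
Proof. by rewrite subr_ge0 invf_le1 // (le_trans _ y10) // ler1n. Qed.
Let p1 : p <= 1. Proof. by rewrite gerBl ltW. Qed.
Let pq : 1 - p = q. Proof. by rewrite /p; ring. Qed.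

(** The following predicates are the exceptional events of the lower bound. *)
Definition sparse_pair E := `[< exists S S' : {set 'I_n},
  [/\ #|S| = #|S'|, 8 * y ^+ 3 <= #|S|%:R &
    #|finset.setX S S' :\: E|%SET%:R <= 5 / 6 * (q * #|finset.setX S S'|%:R)] >].

Definition echo_rich E := `[< exists phi : {ffun 'I_n -> 'I_n}, exists B B' : {set 'I_n},
  8 * y ^+ 3 <= #|B'|%:R /\
    2 * (q ^+ 2 * (n%:R * #|B'|%:R)) <= #|echoes (~: E)%SET phi B B'|%:R >].

Definition rich_triple E := `[< exists U : {set 'I_n},
  #|U| = 3 /\ 5 / 3 * (n%:R * q ^+ #|U|) <= (codegree E U)%:R >].

Lemma rich_triple_codegree E : ~~ rich_triple E ->
  triple_codegree_le (~: E)%SET (Num.truncn (5 / 3 * y)).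
Proof.
move=> /asboolPn nr a1 a2 a3 n12 n13 n23.
rewrite truncn_ge_nat; last by have := y0; lra.
rewrite leNgt; apply/negP => lt; apply: nr; exists [set a1; a2; a3]%SET.
have c3 : #|[set a1; a2; a3]%SET| = 3.
  by rewrite finset.setUC cardsU1 cards2 n12 !inE negb_or !(eq_sym a3) n13 n23.
split=> //; rewrite c3 yn.
have -> : y ^+ 4 * q ^+ 3 = y.
  have -> : y ^+ 4 * q ^+ 3 = y * (q * y) ^+ 3 by ring.
  by rewrite qy expr1n mulr1.
apply/ltW; apply: lt_le_trans lt _; rewrite ler_nat.
apply/subset_leq_card/fintype.subsetP => b; rewrite !inE => /and3P[h1 h2 h3].
by apply/forall_inP => u; rewrite !inE => /orP[/orP[]|] /eqP ->.
Qed.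

(** With [s = n - order_dim], the product [B x B'] would contain more than
[5/6 s^2 / y >= 20/3 y^2 s] incomparable pairs, but at most
[4 y^2 s + 20 y^5] of them are covered, and [y^2 s >= 8 y^5]. *)
Lemma order_dim_ge E : ~~ sparse_pair E -> ~~ echo_rich E ->
  ~~ echo_rich (transpose E) -> ~~ rich_triple E -> ~~ rich_triple (transpose E) ->
  biclique9_free (~: E)%SET ->
  n%:R - 8 * y ^+ 3 <= (order_dim (bipartite E))%:R.
Proof.
move=> /asboolPn sp /asboolPn er /asboolPn er' rt rt' K9.
rewrite leNgt; apply/negP; set t := order_dim _ => lt.
have y30 : 0 < y ^+ 3 by rewrite exprn_gt0.
have ltn : (t < n)%N by rewrite -(ltr_nat R); lra.
have := rich_triple_codegree rt'; rewrite -transposeC => cod'.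
have [B [B' [phi [phi' [cB cB' card]]]]] :=
  realizer_cover (order_dimP _) ltn K9 (rich_triple_codegree rt) cod'.
set M := Num.truncn _ in card.
have leM : M%:R <= 5 / 3 * y by rewrite /M truncn_le; have := y0; lra.
pose s : R := (n - t)%:R.
have sE : s = n%:R - t%:R by rewrite /s natrB // ltnW.
have s8 : 8 * y ^+ 3 <= s by rewrite sE; move: lt; rewrite -/t; lra.
have lt1 : 5 / 6 * (q * (s * s)) < #|(~: E :&: finset.setX B B')%SET|%:R.
  rewrite ltNge; apply/negP => le; apply: sp; exists B, B'; rewrite cB cB'; split=> //.
  rewrite cardsX cB cB' natrM; apply: le_trans le.
  by rewrite ler_nat finset.setDE finset.setIC.
have q2n : q ^+ 2 * n%:R = y ^+ 2.
  rewrite yn; have -> : q ^+ 2 * y ^+ 4 = (q * y) ^+ 2 * y ^+ 2 by ring.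
  by rewrite qy expr1n mul1r.
have lt2 : #|echoes (~: E)%SET phi B B'|%:R < 2 * (y ^+ 2 * s).
  rewrite ltNge; apply/negP => le; apply: er; exists phi, B, B'.
  by rewrite cB' [q ^+ 2 * _]mulrA q2n.
have lt3 : #|echoes (transpose (~: E)%SET) phi' B' B|%:R < 2 * (y ^+ 2 * s).
  rewrite ltNge; apply/negP => le; apply: er'; exists phi', B', B.
  by rewrite cB [q ^+ 2 * _]mulrA q2n -transposeC.
have {}card : #|(~: E :&: finset.setX B B')%SET|%:R <=
    #|echoes (~: E)%SET phi B B'|%:R + #|echoes (transpose (~: E)%SET) phi' B' B|%:R
    + 12 * (t%:R * M%:R) :> R.
  by rewrite -natrM -[12 * _]natrM -!natrD ler_nat.
have tM : t%:R * M%:R <= y ^+ 4 * (5 / 3 * y).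
  by apply: ler_pM; rewrite // -yn ler_nat ltnW.
have qs : 8 * (y ^+ 2 * s) <= q * (s * s).
  have -> : 8 * (y ^+ 2 * s) = q * (8 * y ^+ 3 * s).
    by rewrite -[LHS]mul1r -qy; ring.
  by rewrite ler_wpM2l ?(ltW q0) // ler_wpM2r.
have ys : 8 * (y ^+ 4 * y) <= y ^+ 2 * s.
  have -> : 8 * (y ^+ 4 * y) = y ^+ 2 * (8 * y ^+ 3) by ring.
  by rewrite ler_wpM2l // exprn_ge0 // ltW.
have y50 : 0 < y ^+ 4 * y by rewrite mulr_gt0 // exprn_gt0.
lra.
Qed.

Lemma card_set_ord m : #|{: {set 'I_m}}| = (2 ^ m)%N.
Proof. by rewrite -cardsT -finset.powersetT card_powerset cardsT card_ord. Qed.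

Lemma expRN_le (c x : R) : 0 < c -> 0 < x -> c <= x -> expR (- x) <= c^-1.
Proof.
move=> c0 x0 cx; rewrite expRN lef_pV2 ?posrE ?expR_gt0 //.
by apply: le_trans cx _; apply: le_trans (expR_ge1Dx _); lra.
Qed.

Let y5 : 10 * y ^+ 4 <= y ^+ 5.
Proof. by rewrite [y ^+ 5]exprS ler_wpM2r // exprn_ge0 // ltW. Qed.

Let yy4 : y <= y ^+ 4.
Proof. by rewrite exprS ler_peMr ?exprn_ege1 ?ltW // (lt_le_trans _ y10) // ltr1n. Qed.

Lemma Pr_sparse_pair : Pr_Omega p sparse_pair <= y^-1.
Proof.
pose P (i : {set 'I_n} * {set 'I_n}) := (#|i.1| == #|i.2|) && (8 * y ^+ 3 <= #|i.1|%:R).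
pose Q (i : {set 'I_n} * {set 'I_n}) E :=
  #|finset.setX i.1 i.2 :\: E|%SET%:R <= 5 / 6 * (q * #|finset.setX i.1 i.2|%:R).
apply: le_trans (@Pr_union _ _ _ p0 p1 _ P _ Q (expR (- (64 / 120 * y ^+ 5))) _ _) _.
- move=> E /asboolP[S [S' [e h1 h2]]]; exists (S, S') => //.
  by rewrite /P e eqxx -e.
- move=> [S S'] /andP[/= /eqP e le].
  have := Pr_few_incomparable p0 p1 (finset.setX S S'); rewrite pq => /le_trans; apply.
  rewrite ler_expR lerN2 cardsX -e natrM.
  have : q * ((8 * y ^+ 3) * (8 * y ^+ 3)) <= q * (#|S|%:R * #|S|%:R).
    apply: ler_wpM2l (ltW q0) _ _ _.
    by apply: ler_pM => //; rewrite mulr_ge0 // exprn_ge0 // ltW.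
  have -> : q * ((8 * y ^+ 3) * (8 * y ^+ 3)) = 64 * ((q * y) * y ^+ 5) by ring.
  by rewrite qy mul1r; lra.
apply: (@le_trans _ _ (expR (n%:R + n%:R) * expR (- (64 / 120 * y ^+ 5)))).
  rewrite ler_wpM2r ?expR_ge0 // expRD.
  apply: le_trans (_ : (2 ^+ n * 2 ^+ n) <= _); last first.
    by rewrite ler_pM ?exprn_ge0 ?pow2_le_expR.
  rewrite -!natrX -natrM ler_nat -card_set_ord -card_prod; exact: max_card.
rewrite -expRD yn; apply: le_trans (_ : expR (- y) <= _); last exact: expRN_le.
by rewrite ler_expR; have := y5; have := yy4; have := y0; lra.
Qed.

Lemma Pr_echo_rich : Pr_Omega p echo_rich <= y^-1.
Proof.
pose P (i : {ffun 'I_n -> 'I_n} * ({set 'I_n} * {set 'I_n})) := 8 * y ^+ 3 <= #|i.2.2|%:R.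
pose Q (i : {ffun 'I_n -> 'I_n} * ({set 'I_n} * {set 'I_n})) E :=
  2 * (q ^+ 2 * (n%:R * #|i.2.2|%:R)) <= #|echoes (~: E)%SET i.1 i.2.1 i.2.2|%:R.
apply: le_trans (@Pr_union _ _ _ p0 p1 _ P _ Q (expR (- (2 * y ^+ 5))) _ _) _.
- by move=> E /asboolP[phi [B [B' [h1 h2]]]]; exists (phi, (B, B')).
- move=> [phi [B B']]; rewrite /P /Q /= => le.
  have := Pr_many_echoes p0 p1 phi B B'; rewrite pq => /le_trans; apply.
  rewrite ler_expR lerN2 yn.
  have -> : q ^+ 2 * (y ^+ 4 * #|B'|%:R) = (q * y) ^+ 2 * (y ^+ 2 * #|B'|%:R) by ring.
  rewrite qy expr1n mul1r.
  have : y ^+ 2 * (8 * y ^+ 3) <= y ^+ 2 * #|B'|%:R.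
    by rewrite ler_wpM2l // exprn_ge0 // ltW.
  have -> : y ^+ 2 * (8 * y ^+ 3) = 8 * y ^+ 5 by ring.
  lra.
apply: (@le_trans _ _ (expR (n%:R * (y / 100) + (n%:R + n%:R)) * expR (- (2 * y ^+ 5)))).
  rewrite ler_wpM2r ?expR_ge0 // !expRD.
  apply: le_trans (_ : n%:R ^+ n * (2 ^+ n * 2 ^+ n) <= _); last first.
    rewrite ler_pM ?exprn_ge0 ?mulr_ge0 ?exprn_ge0 //.
      by rewrite expRM_natl lerXn2r ?nnegrE ?expR_ge0.
    by rewrite ler_pM ?exprn_ge0 ?pow2_le_expR.
  rewrite -!natrX -!natrM ler_nat -card_set_ord.
  apply: leq_trans (max_card _) _.
  by rewrite !card_prod card_ffun !card_ord.
rewrite -expRD yn; apply: le_trans (_ : expR (- y) <= _); last exact: expRN_le.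
have -> : y ^+ 4 * (y / 100) = y ^+ 5 / 100 by ring.
by rewrite ler_expR; have := y5; have := yy4; have := y0; lra.
Qed.

Lemma Pr_rich_triple : Pr_Omega p rich_triple <= 100 / y.
Proof.
pose P (U : {set 'I_n}) := #|U| == 3.
pose Q (U : {set 'I_n}) E := 5 / 3 * (n%:R * q ^+ #|U|) <= (codegree E U)%:R.
apply: le_trans (@Pr_union _ _ _ p0 p1 _ P _ Q (expR (- (y / 24))) _ _) _.
- by move=> E /asboolP[U [/eqP h1 h2]]; exists U.
- move=> U; rewrite /P /Q => /eqP cU.
  have := Pr_large_codegree p0 p1 U; rewrite pq cU => /le_trans; apply.
  rewrite ler_expR lerN2 yn.
  have -> : y ^+ 4 * q ^+ 3 = (q * y) ^+ 3 * y by ring.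
  by rewrite qy expr1n mul1r.
apply: (@le_trans _ _ (expR (3%:R * (y / 100)) * expR (- (y / 24)))).
  rewrite ler_wpM2r ?expR_ge0 // expRM_natl.
  apply: le_trans (_ : n%:R ^+ 3 <= _); last first.
    by rewrite lerXn2r ?nnegrE ?expR_ge0.
  rewrite -natrX ler_nat.
  have -> : #|P| = #|[set U : {set 'I_n} | #|U| == 3]%SET| by rewrite cardsE.
  rewrite card_draws card_ord; apply: leq_trans (_ : n ^_ 3 <= _)%N.
    by rewrite -bin_ffact leq_pmulr.
  rewrite ffact_prod; apply: leq_trans (_ : \prod_(i < 3) n <= _)%N.
    by apply: leq_prod => i _; exact: leq_subr.
  by rewrite prod_nat_const card_ord.
rewrite -expRD; apply: le_trans (_ : expR (- (y / 100)) <= _).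
  by rewrite ler_expR; have := y0; lra.
by rewrite -[leRHS]invf_div expRN_le // divr_gt0.
Qed.

Lemma Pr_biclique9_le : Pr_Omega p (fun E => `[< ~ biclique9_free (~: E)%SET >]) <= y^-1.
Proof.
have := Pr_biclique9 n p0 p1; rewrite pq yn => /le_trans; apply.
have -> : (y ^+ 4) ^+ 18 * q ^+ 81 = (q * y) ^+ 72 * (q * q ^+ 8).
  by rewrite -exprM exprMn -exprS [RHS]mulrAC -exprD [RHS]mulrC.
rewrite qy expr1n mul1r ler_piMr ?(ltW q0) // exprn_ile1 ?(ltW q0) //.
by rewrite invf_le1 // (le_trans _ y10) // ler1n.
Qed.

Lemma Pr_order_dim_lt :
  Pr_Omega p (fun E => ~~ (n%:R - 8 * y ^+ 3 <= (order_dim (bipartite E))%:R))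
    <= 204 / y.
Proof.
have tr (A : pred {set 'I_n * 'I_n}) c : Pr_Omega p A <= c ->
    Pr_Omega p (fun E => A (transpose E)) <= c by rewrite Pr_transpose.
pose C E := echo_rich E || echo_rich (transpose E).
pose D E := rich_triple E || rich_triple (transpose E).
pose K E := `[< ~ biclique9_free (~: E)%SET >].
have orE (b c : bool) : b || c -> b \/ c by move/orP.
apply: le_trans (@Pr_union2 _ _ _ p0 p1 _ sparse_pair (fun E => [|| C E, D E | K E]) _) _.
  move=> E; case: (boolP (sparse_pair E)) => [|sp]; first by left.
  rewrite /C /D; case: (boolP (echo_rich E)) => [|e1]; first by right.
  case: (boolP (echo_rich (transpose E))) => [|e2]; first by right.
  case: (boolP (rich_triple E)) => [|e3]; first by right.
  case: (boolP (rich_triple (transpose E))) => [|e4]; first by right.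
  case: (boolP (K E)) => [|/asboolPn/contrapT e5]; first by right.
  by rewrite order_dim_ge.
have hC : Pr_Omega p C <= y^-1 + y^-1.
  apply: le_trans (Pr_union2 p0 p1 (fun E => @orE _ _)) _.
  by apply: lerD; [|apply: tr]; exact: Pr_echo_rich.
have hD : Pr_Omega p D <= 100 / y + 100 / y.
  apply: le_trans (Pr_union2 p0 p1 (fun E => @orE _ _)) _.
  by apply: lerD; [|apply: tr]; exact: Pr_rich_triple.
have hDK : Pr_Omega p (fun E => D E || K E) <= 100 / y + 100 / y + y^-1.
  apply: le_trans (Pr_union2 p0 p1 (fun E => @orE _ _)) _.
  by apply: lerD => //; exact: Pr_biclique9_le.
have hCDK : Pr_Omega p (fun E => [|| C E, D E | K E]) <= y^-1 + y^-1 + (100 / y + 100 / y + y^-1).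
  apply: le_trans (Pr_union2 p0 p1 (fun E => @orE _ _)) _.
  exact: lerD.
by apply: le_trans (lerD Pr_sparse_pair hCDK) _; lra.
Qed.

End LowerBound.

(** * The upper bound *)

Lemma quarter_le (n k : nat) :
  (100 * k <= n)%N -> (3 * (n %/ 4) <= n - 13 * k)%N.
Proof. by have := leq_trunc_div n 4; lia. Qed.

Lemma matching_size_bounds (n k m : nat) : (0 < k)%N -> (100 * k <= n)%N ->
  (n - 13 * k < m + 12 * k)%N -> (m < n - 13 * k + 12 * k)%N ->
  (2 < m)%N /\ (m + k <= n)%N.
Proof. by lia. Qed.

Section UpperBound.
Variables (R : realType) (n : nat) (y : R).
(* Half of a lower bound for [(1 - q) ^+ (13 * k)], as [2 * q * (13 * k) <= 52]. *)
Let kappa : R := expR (- 52) / 2.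
Hypotheses (yn : n%:R = y ^+ 5) (y200 : 200 <= y) (ny : n%:R <= expR (y / 100)).
Hypothesis (yk : 27 <= y * kappa).
Let q := y ^- 4.
Let p := 1 - q.
(* An integer with [y ^+ 4 <= k <= 2 * y ^+ 4]. *)
Let k := (Num.truncn (y ^+ 4)).+1.
Implicit Types (E : {set 'I_n * 'I_n}).

Let y0 : 0 < y. Proof. by apply: lt_le_trans y200. Qed.
Let y4gt0 : 0 < y ^+ 4. Proof. exact: exprn_gt0. Qed.
Let q0 : 0 < q. Proof. by rewrite invr_gt0. Qed.
Let qy : q * y ^+ 4 = 1. Proof. by rewrite mulVf // gt_eqF. Qed.
Let yy4 : 200 * y <= y ^+ 4.
Proof.
have : 200 <= y ^+ 3.
  apply: le_trans y200 _; rewrite exprS; apply: ler_peMr; first exact: ltW.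
  by apply: exprn_ege1; apply: le_trans y200; lra.
by rewrite [y ^+ 4]exprSr; exact: ler_wpM2r (ltW y0) _ _.
Qed.
Let y45 : 200 * y ^+ 4 <= y ^+ 5.
Proof. by rewrite [y ^+ 5]exprS ler_wpM2r // ltW. Qed.
Let q_half : q <= 1 / 2.
Proof. by have := qy; have := yy4; have := y200; have := q0; nra. Qed.
Let p0 : 0 <= p. Proof. by have := q_half; rewrite /p; lra. Qed.
Let p1 : p <= 1. Proof. by rewrite gerBl ltW. Qed.
Let pq : 1 - p = q. Proof. by rewrite /p; ring. Qed.
Let k_ge : y ^+ 4 <= k%:R. Proof. exact/ltW/truncnS_gt. Qed.
Let k_le : k%:R <= 2 * y ^+ 4.
Proof.
have : (Num.truncn (y ^+ 4))%:R <= y ^+ 4 by rewrite truncn_le ltW.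
by rewrite /k -natr1; have := yy4; have := y200; lra.
Qed.
Let k_small : (100 * k <= n)%N.
Proof. by rewrite -(ler_nat R) natrM yn; have := k_le; have := y45; lra. Qed.

(** Among the common non-neighbours of [V] in the incomparability graph, 13 k are
chosen; the maximal matching then has fewer than [n - 13 k + 12 k] edges. *)
Lemma order_dim_le_of_holes E (V : {set 'I_n}) : #|V| = (13 * k)%N ->
  no_nested (~: E)%SET -> no_nested (transpose (~: E)%SET) ->
  no_hole (~: E)%SET (12 * k) (n %/ 4) ->
  no_hole (transpose (~: E)%SET) (12 * k) (n %/ 4) ->
  (13 * k < #|[set b | [forall v in V, (v, b) \in E]]%SET|)%N ->
  (order_dim (bipartite E))%:R <= n%:R - y ^+ 4.
Proof.
move=> cV nn nn' nh nh' /ltnW; rewrite cardE => big.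
set W := finset _ in big.
pose B' := [set x in take (13 * k) (enum W)]%SET.
have cB' : #|B'| = (13 * k)%N.
  rewrite cardsE (card_uniqP _) ?take_uniq ?enum_uniq //.
  by rewrite size_takel.
have dis : [disjoint finset.setX V B' & (~: E)%SET].
  rewrite finset.disjoints_subset finset.setCK; apply/fintype.subsetP => -[v b].
  rewrite finset.in_setX => /andP[/= vV]; rewrite inE => /mem_take.
  by rewrite mem_enum inE => /forall_inP; apply.
have [||M maxM /andP[]] := @small_maximal_matching n (~: E)%SET V B' _ _ nh nh' _ _ dis.
- by rewrite cV cB'.
- by rewrite cV quarter_le.
rewrite cV => lo hi.
have [M3 Mk] := matching_size_bounds (ltn0Sn _ : (0 < k)%N) k_small lo hi.
have := order_dim_le (maximal_matching_realizes maxM M3 nn nn').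
rewrite -(ler_nat R) => le; apply: le_trans le _.
move: Mk; rewrite -(ler_nat R) natrD; have := k_ge; lra.
Qed.

Lemma Pr_nested_le :
  Pr_Omega p (fun E => `[< ~ no_nested (~: E)%SET >]) <= 3 / y.
Proof.
have := Pr_nested n p0 p1; rewrite pq => /le_trans; apply.
apply: (@le_trans _ _ (expR (2%:R * (y / 100)) * expR (- (y / 2)))).
  apply: ler_pM; rewrite ?exprn_ge0 ?expR_ge0 //.
    by rewrite expRM_natl lerXn2r ?nnegrE ?expR_ge0.
  rewrite ler_expR lerN2 yn.
  have -> : y ^+ 5 * (p * q) = p * (y * (q * y ^+ 4)) by ring.
  rewrite qy mulr1 mulrC ler_wpM2r ?(ltW y0) //.
  by rewrite /p; have := q_half; lra.
rewrite -expRD; apply: le_trans (_ : expR (- (y / 3)) <= _).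
  by rewrite ler_expR; have := y0; lra.
by rewrite -[leRHS]invf_div expRN_le // divr_gt0.
Qed.

Lemma Pr_hole_le :
  Pr_Omega p (fun E => `[< ~ no_hole (~: E)%SET (12 * k) (n %/ 4) >]) <= y^-1.
Proof.
have := Pr_hole n p0 p1 (12 * k) (n %/ 4); rewrite pq => /le_trans; apply.
have n4 : n%:R <= 4 * (n %/ 4)%:R + 3 :> R.
  by rewrite -natrM -natrD ler_nat {1}(divn_eq n 4) mulnC leq_add2l -ltnS ltn_mod.
have qk : 1 <= q * k%:R.
  by rewrite -[leLHS]qy; exact: ler_wpM2l (ltW q0) _ _ k_ge.
have qkz : (n %/ 4)%:R <= q * k%:R * (n %/ 4)%:R by exact: ler_peMl (ler0n _ _) qk.
apply: (@le_trans _ _ (expR (n%:R + n%:R) * expR (- (12 * (n %/ 4)%:R)))).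
  apply: ler_pM; rewrite ?exprn_ge0 ?expR_ge0 //.
    have -> : 4 = 2 * 2 :> R by ring.
    by rewrite exprMn expRD ler_pM ?exprn_ge0 ?pow2_le_expR.
  rewrite ler_expR lerN2 !natrM.
  have -> : q * (12 * k%:R * (n %/ 4)%:R) = 12 * (q * k%:R * (n %/ 4)%:R) by ring.
  by rewrite ler_wpM2l.
rewrite -expRD; apply: le_trans (_ : expR (- y) <= _); last exact: expRN_le.
by rewrite ler_expR; have := y45; have := yy4; have := y200; move: n4; rewrite yn; lra.
Qed.

Lemma Pr_few_common_above_le (V : {set 'I_n}) : #|V| = (13 * k)%N ->
  Pr_Omega p (fun E =>
    (#|[set b | [forall v in V, (v, b) \in E]]%SET| <= 13 * k)%N) <= y^-1.
Proof.
move=> cV; have := Pr_few_common_above p0 p1 V (13 * k); move/le_trans; apply.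
have pexp : expR (- (2 * q)) <= p.
  have h1 : 1 + 2 * q <= expR (2 * q) by exact: expR_ge1Dx.
  have h2 : 1 <= (1 + 2 * q) * p.
    by rewrite /p; have := q_half; have := q0; nra.
  rewrite expRN -[leLHS]mulr1 mulrC ler_pdivrMr ?expR_gt0 //.
  by apply: le_trans h2 _; rewrite mulrC ler_wpM2l.
have ppow : expR (- 52) <= p ^+ #|V|.
  rewrite cV; apply: le_trans (_ : expR (- (2 * q)) ^+ (13 * k) <= _); last first.
    by rewrite lerXn2r ?nnegrE ?expR_ge0.
  rewrite -expRM_natl ler_expR natrM mulrN lerN2.
  have : q * k%:R <= q * (2 * y ^+ 4) by rewrite ler_wpM2l ?(ltW q0).
  have -> : q * (2 * y ^+ 4) = 2 * (q * y ^+ 4) by ring.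
  rewrite qy; lra.
apply: (@le_trans _ _ (expR (13 * k)%:R * expR (- (y ^+ 5 * kappa)))).
  apply: ler_pM; rewrite ?exprn_ge0 ?expR_ge0 ?pow2_le_expR //.
  rewrite ler_expR lerN2 yn ler_wpM2l ?exprn_ge0 ?(ltW y0) //.
  by rewrite /kappa ler_wpM2r.
rewrite -expRD; apply: le_trans (_ : expR (- y) <= _); last exact: expRN_le.
have : y ^+ 4 * 27 <= y ^+ 5 * kappa.
  by rewrite [y ^+ 5]exprSr -mulrA ler_wpM2l // ltW.
by rewrite ler_expR natrM; have := k_le; have := yy4; have := y0; lra.
Qed.

Lemma Pr_order_dim_gt :
  Pr_Omega p (fun E => ~~ ((order_dim (bipartite E))%:R <= n%:R - y ^+ 4))
    <= 9 / y.
Proof.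
have tr (A : pred {set 'I_n * 'I_n}) c : Pr_Omega p A <= c ->
    Pr_Omega p (fun E => A (transpose E)) <= c by rewrite Pr_transpose.
have orE (b c : bool) : b || c -> b \/ c by move/orP.
pose V : {set 'I_n} := [set x in take (13 * k) (enum 'I_n)]%SET.
have cV : #|V| = (13 * k)%N.
  rewrite cardsE (card_uniqP _) ?take_uniq ?enum_uniq //.
  by rewrite size_takel // size_enum_ord (leq_trans _ k_small) // leq_mul2r orbT.
pose N E := `[< ~ no_nested (~: E)%SET >].
pose H E := `[< ~ no_hole (~: E)%SET (12 * k) (n %/ 4) >].
pose F E := (#|[set b | [forall v in V, (v, b) \in E]]%SET| <= 13 * k)%N.
pose NN E := N E || N (transpose E).
pose HH E := H E || H (transpose E).
apply: le_trans (@Pr_union2 _ _ _ p0 p1 _ F (fun E => NN E || HH E) _) _.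
  move=> E; case: (boolP (F E)) => [|]; first by left.
  rewrite -ltnNge /NN /HH => big.
  case: (boolP (N E)) => [|/asboolPn/contrapT nn]; first by right.
  case: (boolP (N (transpose E))) => [|/asboolPn/contrapT]; first by right.
  rewrite -transposeC => nn'.
  case: (boolP (H E)) => [|/asboolPn/contrapT nh]; first by right.
  case: (boolP (H (transpose E))) => [|/asboolPn/contrapT]; first by right.
  rewrite -transposeC => nh'.
  by rewrite (order_dim_le_of_holes cV).
have hN : Pr_Omega p NN <= 3 / y + 3 / y.
  apply: le_trans (Pr_union2 p0 p1 (fun E => @orE _ _)) _.
  by apply: lerD; [|apply: tr]; exact: Pr_nested_le.
have hH : Pr_Omega p HH <= y^-1 + y^-1.
  apply: le_trans (Pr_union2 p0 p1 (fun E => @orE _ _)) _.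
  by apply: lerD; [|apply: tr]; exact: Pr_hole_le.
have hNH : Pr_Omega p (fun E => NN E || HH E) <= 3 / y + 3 / y + (y^-1 + y^-1).
  apply: le_trans (Pr_union2 p0 p1 (fun E => @orE _ _)) _.
  exact: lerD.
by apply: le_trans (lerD (Pr_few_common_above_le cV) hNH) _; lra.
Qed.

End UpperBound.

(** * Passage to the limit *)

Section Limit.
Variable R : realType.

Definition nat_root (k n : nat) : R := n%:R `^ k%:R^-1.

Lemma nat_root_pow k n j : (0 < k)%N -> n%:R `^ (j%:R / k%:R) = nat_root k n ^+ j.
Proof.
by move=> k0; rewrite mulrC powRrM -powR_mulrn ?powR_ge0.
Qed.

Lemma nat_rootK k n : (0 < k)%N -> nat_root k n ^+ k = n%:R.
Proof.
move=> k0; rewrite -nat_root_pow // divff ?pnatr_eq0 -?lt0n // powRr1 //.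
Qed.

Lemma nat_root_unbounded k (K : R) : (0 < k)%N ->
  exists n0, forall n, (n0 <= n)%N -> K <= nat_root k n.
Proof.
move=> k0; pose m := (Num.truncn `|K|).+1.
have Km : K <= m%:R by apply: le_trans (ler_norm _) _; exact/ltW/truncnS_gt.
exists (m ^ k)%N => n mn; apply: le_trans Km _.
rewrite -(@ler_pXn2r _ k) ?nnegrE ?powR_ge0 //.
by rewrite nat_rootK // -natrX ler_nat.
Qed.

(** From [1 + x <= expR x] at [x = y c / (k + 1)], raised to the power [k + 1]. *)
Lemma nat_root_expR k n (c : R) : (0 < k)%N -> 0 < c ->
  (k.+1%:R / c) ^+ k.+1 <= nat_root k n -> n%:R <= expR (nat_root k n * c).
Proof.
move=> k0 c0; set y := nat_root k n => le.
have y0 : 0 <= y by exact: powR_ge0.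
have kc : 0 < k.+1%:R / c by rewrite divr_gt0.
have : (y * c / k.+1%:R) ^+ k.+1 <= expR (y * c).
  set x := _ / _; have -> : y * c = k.+1%:R * x by rewrite [RHS]mulrC divfK ?pnatr_eq0.
  have x0 : 0 <= x by rewrite divr_ge0 // mulr_ge0 // ltW.
  rewrite expRM_natl lerXn2r ?nnegrE ?expR_ge0 //.
  by apply: le_trans (expR_ge1Dx _); rewrite lerDr.
apply: le_trans; rewrite -(nat_rootK n k0) -/y.
have -> : y * c / k.+1%:R = y / (k.+1%:R / c) by rewrite invf_div mulrA.
rewrite expr_div_n ler_pdivlMr ?exprn_gt0 // [leRHS]exprSr.
by rewrite ler_wpM2l // exprn_ge0.
Qed.

(** A failure probability of order [n^(-1/k)] tends to 0. *)
Lemma aas_root k (p : nat -> R) (A : forall n, pred {set 'I_n * 'I_n}) (C K : R) :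
  (0 < k)%N ->
  (forall n, (0 < n)%N -> K <= nat_root k n ->
    0 <= p n <= 1 /\ Pr_Omega (p n) (fun E => ~~ A n E) <= C / nat_root k n) ->
  aas p A.
Proof.
move=> k0 H; apply/cvgrPdist_lt => e e0.
have [n0 hn0] := nat_root_unbounded (Num.max K (Num.max 1 (`|C| / e + 1))) k0.
exists n0.+1 => // n /= /ltnW ln; have := hn0 n ln.
rewrite !ge_max => /and3P[Kn y1 Cn].
have y0 : 0 < nat_root k n by exact: lt_le_trans y1.
have npos : (0 < n)%N.
  by rewrite -(ltr_nat R) -(nat_rootK n k0) exprn_gt0.
have [/andP[p0 p1] le] := H n npos Kn.
rewrite Pr_compl //.
rewrite ger0_norm; last exact: Pr_ge0.
apply: le_lt_trans le _; rewrite ltr_pdivrMr // mulrC -ltr_pdivrMr //.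
apply: lt_le_trans Cn; apply: le_lt_trans (_ : _ <= `|C| / e) _.
  by rewrite ler_wpM2r ?invr_ge0 ?(ltW e0) // ler_norm.
by rewrite ltrDl.
Qed.

End Limit.

Theorem mainTheorem3 (R : realType) (q : nat -> R) :
  ((forall n : nat, (0 < n)%N -> q n = n%:R `^ (- (1 / 4))) ->
    aas (fun n => 1 - q n) (fun n (E : {set 'I_n * 'I_n}) =>
      n%:R - 8 * n%:R `^ (3 / 4) <= (order_dim (bipartite E))%:R :> R))
  /\
  ((forall n : nat, (0 < n)%N -> q n = n%:R `^ (- (4 / 5))) ->
    aas (fun n => 1 - q n) (fun n (E : {set 'I_n * 'I_n}) =>
      (order_dim (bipartite E))%:R <= n%:R - n%:R `^ (4 / 5) :> R)).
Proof.
have inv01 (x : R) : 1 <= x -> 0 <= 1 - x^-1 <= 1.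
  move=> x1; have x0 : 0 < x by exact: lt_le_trans x1.
  by rewrite subr_ge0 gerBl invr_ge0 (ltW x0) invf_le1 // x1.
split=> hq.
- pose K : R := Num.max 10 ((5%:R / (1 / 100)) ^+ 5).
  apply: (@aas_root R 4 _ _ 204 K) => // n n0.
  rewrite ge_max => /andP[y10 /(nat_root_expR _)] ny.
  have qE : q n = (nat_root R 4 n)^-1.
    by rewrite hq // powRN (@nat_root_pow R 4 n 1).
  rewrite qE; split; first by apply: inv01; apply: le_trans y10; lra.
  rewrite (@nat_root_pow R 4 n 3) //; apply: Pr_order_dim_lt => //.
    by rewrite nat_rootK.
  by have := ny; rewrite div1r; apply; rewrite ?invr_gt0.
- pose K : R := Num.max (27 / (expR (- 52) / 2)) (Num.max 200 ((6%:R / (1 / 100)) ^+ 6)).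
  apply: (@aas_root R 5 _ _ 9 K) => // n n0.
  rewrite !ge_max => /and3P[yk y200 /(nat_root_expR _)] ny.
  have qE : q n = (nat_root R 5 n) ^- 4.
    by rewrite hq // powRN (@nat_root_pow R 5 n 4).
  rewrite qE; split.
    by apply: inv01; apply: exprn_ege1; apply: le_trans y200; lra.
  rewrite (@nat_root_pow R 5 n 4) //; apply: Pr_order_dim_gt => //.
  + by rewrite nat_rootK.
  + by have := ny; rewrite div1r; apply; rewrite ?invr_gt0.
  + by rewrite -ler_pdivrMr // divr_gt0 ?expR_gt0.
Qed.
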